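(* Let $\mu>0$ and let $x^*$ be the optimal solution and $\Psi^*$ the optimal value of $\min_{x\in X}\{\Psi(x)=\sum_{i=1}^m f_i(x)+h(x)+\mu\,\omega(x)\}$. Suppose that in the RPDG method the $i_t$ are distributed according to $$p_i=\mathrm{Prob}\{i_t=i\}=\frac1{2m}+\frac{L_i}{2L},\quad i=1,\dots,m,$$ and $\tau_t=\tau$, $\eta_t=\eta$, $\alpha_t=\alpha$ for all $t\ge 1$ with $$\tau=\frac{\sqrt{(m-1)^2+4mC}-(m-1)}{2m},\quad \eta=\frac{\mu\sqrt{(m-1)^2+4mC}+\mu(m-1)}{2},\quad \alpha=1-\frac{1}{(m+1)+\sqrt{(m-1)^2+4mC}},$$ where $C=8L/\mu$. Let $\bar x^k=(\sum_{t=1}^k\theta_t)^{-1}\sum_{t=1}^k\theta_tx^t$ with $\theta_t=\alpha^{-t}$. Then for any $k\ge1$, $$\mathbb{E}[P(x^k,x^* )]\le\Big(1+\frac{3L_f}{\mu}\Big)\alpha^kP(x^0,x^* ),$$ $$\mathbb{E}[\Psi(\bar x^k)-\Psi^*]\le\alpha^{k/2}(1-\alpha)^{-1}\Big[\mu+2L_f+\frac{L_f^2}{\mu}\Big]P(x^0,x^* ).$$ As a consequence, the number of iterations performed by the RPDG method to find a stochastic $\epsilon$-solution and a stochastic $(\epsilon,\lambda)$-solution in terms of the distance to the optimal solution can be bounded by $K(\epsilon,C)$ and $K(\lambda\epsilon,C)$, respectively, where $$K(\epsilon,C):=\Big[(m+1)+\sqrt{(m-1)^2+4mC}\Big]\log\Big[\Big(1+\frac{3L_f}{\mu}\Big)\frac{P(x^0,x^*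 )}{\epsilon}\Big].$$ Similarly, the number of iterations performed to find a stochastic $\epsilon$-solution and a stochastic $(\epsilon,\lambda)$-solution in terms of the primal optimality gap can be bounded by $\tilde K(\epsilon,C)$ and $\tilde K(\lambda\epsilon,C)$, respectively, where $$\tilde K(\epsilon,C):=2\Big[(m+1)+\sqrt{(m-1)^2+4mC}\Big]\log\Big[2\Big(\mu+2L_f+\frac{L_f^2}{\mu}\Big)(m+\sqrt{mC})\frac{P(x^0,x^* )}{\epsilon}\Big].$$
   Context: Problem data: $X\subseteq\mathbb{R}^n$ is closed convex; $\|\cdot\|$ is an arbitrary norm on $\mathbb{R}^n$ with conjugate norm $\|\cdot\|_*$; $f_i:\mathbb{R}^n\to\mathbb{R}$ ($i=1,\dots,m$) are convex, differentiable, with $\|\nabla f_i(x_1)-\nabla f_i(x_2)\|_*\le L_i\|x_1-x_2\|$ for all $x_1,x_2$; $f=\sum_if_i$, $L=\sum_iL_i$; $L_f\ge0$ is a constant with $\|\nabla f(x_1)-\nabla f(x_2)\|_*\le L_f\|x_1-x_2\|\le L\|x_1-x_2\|$ for all $x_1,x_2$; $h:X\to\mathbb{R}$ is convex; $\omega:X\to\mathbb{R}$ is strongly convex with modulus $1$ w.r.t. $\|\cdot\|$. Primal prox-function: $P(x^0,x)=\omega(x)-[\omega(x^0)+\langle\omega'(x^0),x-x^0\rangle]$, $\omega'(x^0)\in\partial\omega(x^0)$, so $P(x^0,x)\ge\frac12\|x-x^0\|^2$. Prox-mapping: $\mathcal{M}_X(g,x^0,\eta)=\arg\min_{x\in X}\{\langle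 g,x\rangle+h(x)+\mu\,\omega(x)+\eta P(x^0,x)\}$ (assumed computable, in particular well defined). The subgradients of $\omega$ are selected recursively: if $x^1=\mathcal{M}_X(g,x^0,\eta)$, then $\omega'(x^1)\in\partial\omega(x^1)$ is chosen so that for some $h'(x^1)\in\partial h(x^1)$, $\langle g+h'(x^1)+(\mu+\eta)\omega'(x^1)-\eta\omega'(x^0),x-x^1\rangle\ge0$ for all $x\in X$; this $\omega'(x^1)$ is used in $P(x^1,\cdot)$. RPDG method: given $x^0=x^{-1}\in X$, nonnegative parameters $\{\tau_t\},\{\eta_t\},\{\alpha_t\}$ and probabilities $p_1,\dots,p_m$ summing to $1$, set $\underline x_i^0=x^0$, $y_i^0=\nabla f_i(x^0)$ for all $i$. For $t=1,\dots,k$: draw $i_t$ independently with $\mathrm{Prob}\{i_t=i\}=p_i$; set $\tilde x^t=\alpha_t(x^{t-1}-x^{t-2})+x^{t-1}$; for $i=i_t$ set $\underline x_i^t=(\tilde x^t+\tau_t\underline x_i^{t-1})/(1+\tau_t)$, $y_i^t=\nabla f_i(\underline x_i^t)$, $\tilde y_i^t=p_i^{-1}(y_i^t-y_i^{t-1})+y_i^{t-1}$; for $i\ne i_t$ set $\underline x_i^t=\underline x_i^{t-1}$, $y_i^t=\tilde y_i^t=y_i^{t-1}$; finally $x^t=\mathcal{M}_X(\sum_{i=1}^m\tilde y_i^t,x^{t-1},\eta_t)$. Expectations are over $i_1,\dots,i_k$. Solutions: in terms of the distance to the optimal solution, $\bar x\in X$ is a stochastic $\epsilon$-solution if $\mathbb{E}[P(\bar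 x,x^* )]\le\epsilon$ and a stochastic $(\epsilon,\lambda)$-solution, $\lambda\in(0,1)$, if $\mathrm{Prob}\{P(\bar x,x^* )\le\epsilon\}\ge1-\lambda$ (the point used is $x^k$). In terms of the primal optimality gap, $P(\bar x,x^* )$ is replaced by $\Psi(\bar x)-\Psi^*$ (the point used is $\bar x^k$). *)

(* Defs.v *)
From mathcomp Require Import all_boot all_order all_algebra.
From mathcomp Require Import all_classical all_reals all_analysis.

Set Implicit Arguments.
Unset Strict Implicit.
Unset Printing Implicit Defensive.

Import Order.TTheory GRing.Theory Num.Theory.
Import numFieldNormedType.Exports.

Local Open Scope classical_set_scope.
Local Open Scope ring_scope.

Section euclidean_space.
Context {R : realType} {n : nat}.
Local Notation V := 'rV[R]_n.
Implicit Types (X : set V) (N w : V -> R) (u v x y : V).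

Definition dotp u v : R := \sum_(j < n) u 0 j * v 0 j.

(* The topology on V is the library's (sup-norm) one, which every norm on R^n
   induces; an arbitrary norm is a function N satisfying this predicate. *)
Definition is_norm N : Prop :=
  [/\ forall x y, N (x + y) <= N x + N y,
      forall (a : R) x, N (a *: x) = `|a| * N x &
      forall x, N x = 0 -> x = 0].

Definition dual_norm N u : R := sup [set dotp u x | x in [set x | N x <= 1]].

(* Row of partial derivatives; meaningful where F is differentiable. *)
Definition grad (F : V -> R) x : V :=
  \row_(j < n) 'D_(delta_mx 0 j) (F : V -> R^o) x.

Definition lipschitz_grad N (F : V -> R) (l : R) : Prop :=
  forall x1 x2, dual_norm N (grad F x1 - grad F x2) <= l * N (x1 - x2).

(* Functions X -> R are represented by functions V -> R of which only the
   values on X are ever used. *)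
Definition strongly_convex X N (c : R) w : Prop :=
  forall x y (t : R), X x -> X y -> 0 <= t <= 1 ->
    w (t *: x + (1 - t) *: y)
    <= t * w x + (1 - t) * w y - c / 2 * (t * (1 - t)) * N (x - y) ^+ 2.

Definition subdiff X w x : set V :=
  [set v | forall y, X y -> w x + dotp v (y - x) <= w y].

Definition is_argmin X (F : V -> R) x : Prop :=
  X x /\ forall y, X y -> F x <= F y.

(* P(x0, x), where v0 is the selected subgradient of w at x0. *)
Definition prox_fun w v0 x0 x : R := w x - (w x0 + dotp v0 (x - x0)).

End euclidean_space.

Section rpdg.
Context {R : realType} {n m : nat}.
Local Notation V := 'rV[R]_n.
Variables (X : set V) (f : 'I_m -> V -> R) (h w : V -> R) (mu : R).

(* x1 = M_X(g, x0, eta), and v1 is an admissible choice of w'(x1), given that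
   v0 is the selected w'(x0). *)
Definition prox_step (g x0 v0 : V) (eta : R) (x1 v1 : V) : Prop :=
  [/\ is_argmin X
        (fun x => dotp g x + h x + mu * w x + eta * prox_fun w v0 x0 x) x1,
      subdiff X w x1 v1 &
      exists2 h1, subdiff X h x1 h1 &
        forall x, X x ->
          0 <= dotp (g + h1 + (mu + eta) *: v1 - eta *: v0) (x - x1)].

Variables (p : 'I_m -> R) (tau eta alpha : nat -> R).

(* One sample path of k iterations: i t is the index drawn at iteration t,
   v t the selected subgradient of w at x t, and xu, y, yt stand for the
   underlined x, y and y-tilde.  The step number is t.+1; at t = 0 the term
   x t.-1 is x 0, in accordance with x^{-1} = x^0. *)
Record rpdg_path (x0 v0 : V) (k : nat) (i : nat -> 'I_m)
    (x v : nat -> V) (xu y yt : nat -> 'I_m -> V) : Prop := RpdgPath {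
  rpdg_x0 : x 0%N = x0;
  rpdg_v0 : v 0%N = v0;
  rpdg_xu0 : forall j, xu 0%N j = x0;
  rpdg_y0 : forall j, y 0%N j = grad (f j) x0;
  rpdg_xu : forall t, (t < k)%N ->
    let xt := alpha t.+1 *: (x t - x t.-1) + x t in
    xu t.+1 (i t.+1)
    = (1 + tau t.+1)^-1 *: (xt + tau t.+1 *: xu t (i t.+1));
  rpdg_y : forall t, (t < k)%N ->
    y t.+1 (i t.+1) = grad (f (i t.+1)) (xu t.+1 (i t.+1));
  rpdg_yt : forall t, (t < k)%N ->
    yt t.+1 (i t.+1)
    = (p (i t.+1))^-1 *: (y t.+1 (i t.+1) - y t (i t.+1)) + y t (i t.+1);
  rpdg_other : forall t j, (t < k)%N -> j != i t.+1 ->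
    [/\ xu t.+1 j = xu t j, y t.+1 j = y t j & yt t.+1 j = y t j];
  rpdg_prox : forall t, (t < k)%N ->
    prox_step (\sum_j yt t.+1 j) (x t) (v t) (eta t.+1) (x t.+1) (v t.+1)
}.

End rpdg.

Section randomness.
Context {R : realType} {d : measure_display} {T : measurableType d}.
Variable Pr : probability T R.

(* I 1, ..., I k are random variables with law p, mutually independent. *)
Definition iid_indices {m : nat} (k : nat) (p : 'I_m -> R)
    (I : nat -> T -> 'I_m) : Prop :=
  [/\ forall t (B : set 'I_m), (0 < t <= k)%N -> measurable (I t @^-1` B),
      forall t j, (0 < t <= k)%N -> Pr [set a | I t a = j] = (p j)%:E &
      forall (J : seq nat) (B : nat -> set 'I_m), uniq J ->
        (forall t, t \in J -> (0 < t <= k)%N) ->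
        Pr (\bigcap_(t in [set` J]) I t @^-1` B t)
        = (\prod_(t <- J) Pr (I t @^-1` B t))%E].

(* u t may depend on the draws I 1, ..., I t only. *)
Definition nonanticipating {m : nat} {U : Type} (k : nat)
    (I : nat -> T -> 'I_m) (u : nat -> T -> U) : Prop :=
  forall t a b, (t <= k)%N ->
    (forall s, (0 < s <= t)%N -> I s a = I s b) -> u t a = u t b.

(* z is the random point, gap its (random) error measure. *)
Definition stochastic_sol {U : Type} (X : set U) (z : T -> U) (gap : T -> R)
    (eps : R) : Prop :=
  (forall a, X (z a)) /\ ('E_Pr[gap] <= eps%:E)%E.

Definition stochastic_prob_sol {U : Type} (X : set U) (z : T -> U)
    (gap : T -> R) (eps lambda : R) : Prop :=
  (forall a, X (z a)) /\ ((1 - lambda)%:E <= Pr [set a | gap a <= eps]%R)%E.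

End randomness.

(* Main.v *)
Require Import Defs.
From mathcomp Require Import all_boot all_order all_algebra.
From mathcomp Require Import all_classical all_reals all_analysis.
From mathcomp Require Import measurable_realfun ring lra.

Set Implicit Arguments.
Unset Strict Implicit.
Unset Printing Implicit Defensive.

Import Order.TTheory GRing.Theory Num.Theory.
Import numFieldNormedType.Exports.

Local Open Scope classical_set_scope.
Local Open Scope ring_scope.

(* With [xs] the optimal solution, write [B_i a b] for the Bregman distance of
   [f_i] and [Q z := h z + mu omega z - h xs - mu omega xs + <grad f(xs), z - xs> >= 0].
   Since the dual step is a gradient evaluation, the dual prox-functions of the
   primal-dual analysis are the [B_i] at the underlined points, and the whole
   argument can be run in the primal space. The optimality condition of the
   prox-mapping, the three-point identity of the [B_i] and the estimate
   [<grad f_i a - grad f_i b, w> <= B_i a b / c + c l_i / 2 N(w)^2], which is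
   cocoercivity in a form that avoids the dual norm, yield a Lyapunov function
   [Phi_t >= (mu + eta) P(x^t, xs)] with
   [E (Q x^{t+1} + Phi_{t+1} | i_1, ..., i_t) <= alpha Phi_t].
   The distance rate is immediate. For the gap, sum
   [alpha^-t E (Q x^t) <= ...] over [t], use
   [Psi x^t - Psi xs <= Q x^t + L_f P(x^t, xs)] and Jensen's inequality. *)

(** * Norms and their duals *)

(** A step refreshes one block only. The correction by [1 / p_i] in [ytilde] makes its mean over the
    draw equal to the gradients at the points where all blocks would move; the dual distances in
    [Phi] carry the same weights. The price is the signless cross term
    [- <Gs - sum ytilde, x^t - x^{t-1}>]. The extrapolation makes it recur with factor [alpha], and
    the reserves [eta P(x^{t-1}, x^t)] and [tau / 2 sum B_i / p_i] pay for the change of estimate.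
    With [M = m + 1 + S] the parameters satisfy [tau eta = 8 L], [mu + eta = mu M / 2],
    [1 + tau = M / (2 m)], [1 - alpha = 1 / M]. The first identity pays the cross terms through
    [l_i <= 2 L p_i]. Contraction of the dual part needs [(1 + tau) (1 - alpha) = 1 / (2 m) <= p_i],
    that of the prox part [(1 - alpha) (mu + eta) = mu / 2 <= mu]. The iterates are not assumed
    measurable. They are functions of finitely many draws because the prox point is unique and the
    subgradients are nonanticipating, so expectations become finite sums over words. *)

Section dot_product.
Context {R : realType} {n : nat}.
Implicit Types u v w : 'rV[R]_n.

Lemma dotpDl u v w : dotp (u + v) w = dotp u w + dotp v w.
Proof.
by rewrite /dotp -big_split; apply: eq_bigr => j _; rewrite mxE mulrDl.
Qed.

Lemma dotpDr u v w : dotp u (v + w) = dotp u v + dotp u w.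
Proof.
by rewrite /dotp -big_split; apply: eq_bigr => j _; rewrite mxE mulrDr.
Qed.

Lemma dotpZl (a : R) u v : dotp (a *: u) v = a * dotp u v.
Proof.
by rewrite /dotp mulr_sumr; apply: eq_bigr => j _; rewrite mxE mulrA.
Qed.

Lemma dotpZr (a : R) u v : dotp u (a *: v) = a * dotp u v.
Proof.
by rewrite /dotp mulr_sumr; apply: eq_bigr => j _; rewrite mxE mulrCA.
Qed.

Lemma dotpNl u v : dotp (- u) v = - dotp u v.
Proof. by rewrite -scaleN1r dotpZl mulN1r. Qed.

Lemma dotpNr u v : dotp u (- v) = - dotp u v.
Proof. by rewrite -scaleN1r dotpZr mulN1r. Qed.

Lemma dotp0l u : dotp 0 u = 0.
Proof. by rewrite -(scale0r 0) dotpZl mul0r. Qed.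

Lemma dotp0r u : dotp u 0 = 0.
Proof. by rewrite -(scale0r 0) dotpZr mul0r. Qed.

Lemma dotp_suml (I : finType) (F : I -> 'rV[R]_n) u :
  dotp (\sum_i F i) u = \sum_i dotp (F i) u.
Proof.
by apply: (big_morph (fun z => dotp z u)) => [a b|]; [exact: dotpDl|exact: dotp0l].
Qed.

Definition dotpE :=
  (dotpDl, dotpDr, dotpNl, dotpNr, dotpZl, dotpZr, dotp0l, dotp0r).

End dot_product.

Section norms.
Context {R : realType} {n : nat} (N : 'rV[R]_n -> R).
Hypothesis normN : is_norm N.
Implicit Types u x y : 'rV[R]_n.

Lemma is_norm_triangle x y : N (x + y) <= N x + N y.
Proof. by case: normN. Qed.

Lemma is_normZ (a : R) x : N (a *: x) = `|a| * N x.
Proof. by case: normN. Qed.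

Lemma is_norm0 : N 0 = 0.
Proof. by rewrite -(scale0r 0) is_normZ normr0 mul0r. Qed.

Lemma is_norm0_eq0 x : N x = 0 -> x = 0.
Proof. by case: normN => _ _; apply. Qed.

Lemma is_normN x : N (- x) = N x.
Proof. by rewrite -scaleN1r is_normZ normrN1 mul1r. Qed.

Lemma is_norm_ge0 x : 0 <= N x.
Proof.
have := is_norm_triangle x (- x); rewrite subrr is_norm0 is_normN; lra.
Qed.

Lemma coord_le_norm x (j : 'I_n) : `|x 0 j| <= `|x|.
Proof.
rewrite [leRHS]/Num.norm /= mx_normrE.
by apply/bigmax_geP; right; exists (0, j).
Qed.

Lemma is_norm_le_norm : exists2 c, 0 <= c & forall x, N x <= c * `|x|.
Proof.
exists (\sum_j N ('e_j)); first by apply: sumr_ge0 => j _; exact: is_norm_ge0.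
move=> x; rewrite {1}(row_sum_delta x) mulr_suml.
apply: (@le_trans _ _ (\sum_j N (x 0 j *: 'e_j))).
  elim/big_ind2 : _ => // [|a b a' b' H1 H2]; first by rewrite is_norm0.
  by rewrite (le_trans (is_norm_triangle _ _))// lerD.
apply: ler_sum => j _.
by rewrite is_normZ mulrC ler_wpM2l ?is_norm_ge0// coord_le_norm.
Qed.

Lemma is_norm_continuous : continuous N.
Proof.
have [c c0 Nc] := is_norm_le_norm => x.
apply/(@cvgrPdist_le _ _ _ _ (nbhs_filter x)) => e e0.
apply/nbhs_ballP; exists (e / (c + 1)); first by rewrite /= divr_gt0// ltr_wpDl.
move=> z; rewrite -ball_normE /= => xz.
have dist : `|N x - N z| <= N (x - z).
  rewrite ler_norml; apply/andP; split.
    have := is_norm_triangle (- (x - z)) x.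
    by rewrite opprB subrK -opprB is_normN; lra.
  by have := is_norm_triangle (x - z) z; rewrite subrK; lra.
apply: (le_trans dist); apply: (le_trans (Nc _)).
move: xz; rewrite ltr_pdivlMr ?ltr_wpDl// => /ltW h.
by rewrite mulrC (le_trans _ h)// ler_wpM2l// lerDl.
Qed.

(** The unit sphere of the library norm is compact, so [N] has a minimum on it, positive because [N]
    vanishes only at 0; its inverse is the constant. An empty sphere is split off first. *)
Lemma norm_le_is_norm : exists2 c, 0 <= c & forall x, `|x| <= c * N x.
Proof.
pose A := [set x : 'rV[R]_n | `|x| = 1].
have [[x1 Ax1]|/forallNP A0] := pselect (exists x, A x); last first.
  exists 0 => // x; rewrite mul0r.
  have [->|x0] := eqVneq x 0; first by rewrite normr0.
  by case: (A0 (`|x|^-1 *: x)); rewrite /A/= normrZ normfV normr_id mulVf ?normr_eq0.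
have cA : compact A.
  apply: bounded_closed_compact.
    exists 1; split => // e e1 x /= ->; exact: ltW.
  have -> : A = (fun x : 'rV[R]_n => `|x|) @^-1` [set 1] by [].
  apply: preimage_closed; first by move=> x _; exact: norm_continuous.
  exact: closed_eq.
have [//||x2 Ax2 minx2] := @EVT_min_rV R n N A _ cA _.
- by exists x1.
- by apply: continuous_subspaceT; exact: is_norm_continuous.
have x2N : 0 < N x2.
  rewrite lt_neqAle is_norm_ge0 andbT eq_sym; apply/eqP => /is_norm0_eq0 x20.
  by move: Ax2; rewrite inE /A/= x20 normr0 => /eqP; rewrite eq_sym oner_eq0.
exists (N x2)^-1; first by rewrite invr_ge0 ltW.
move=> x; have [->|x0] := eqVneq x 0.
  by rewrite normr0 mulr_ge0 ?invr_ge0 ?is_norm_ge0.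
rewrite ler_pdivlMl// mulrC.
have /minx2 : `|x|^-1 *: x \in A.
  by rewrite inE /A/= normrZ normfV normr_id mulVf ?normr_eq0.
rewrite is_normZ normfV normr_id ler_pdivlMl ?normr_gt0//.
Qed.

Lemma dotp_le_norm u x : dotp u x <= (\sum_j `|u 0 j|) * `|x|.
Proof.
rewrite mulr_suml; apply: ler_sum => j _.
by rewrite (le_trans (ler_norm _))// normrM ler_wpM2l// coord_le_norm.
Qed.

(** A [sup] dominates its set only if the set is bounded above; the equivalence of norms provides
    this on the unit ball of [N]. *)
Lemma dotp_le_dual_norm u x : dotp u x <= dual_norm N u * N x.
Proof.
have [->|x0] := eqVneq x 0; first by rewrite dotp0r is_norm0 mulr0.
have Nx : 0 < N x.
  rewrite lt_neqAle is_norm_ge0 andbT eq_sym.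
  by apply: contra_neq x0; exact: is_norm0_eq0.
rewrite -ler_pdivrMr// mulrC -dotpZr.
apply: ub_le_sup; last first.
  exists ((N x)^-1 *: x) => //=.
  by rewrite is_normZ ger0_norm ?invr_ge0 ?is_norm_ge0// mulVf ?gt_eqF.
have [c c0 Nc] := norm_le_is_norm.
exists ((\sum_j `|u 0 j|) * c) => _ [z /= Nz <-].
rewrite (le_trans (dotp_le_norm _ _))// ler_wpM2l ?sumr_ge0//.
by rewrite (le_trans (Nc z))// ler_piMr.
Qed.

Lemma is_norm_pos : (0 < n)%N -> exists x, 0 < N x.
Proof.
move=> n0; exists (delta_mx 0 (Ordinal n0)).
rewrite lt_neqAle is_norm_ge0 andbT eq_sym; apply/eqP => /is_norm0_eq0.
by move/rowP/(_ (Ordinal n0)); rewrite !mxE !eqxx => /eqP; rewrite oner_eq0.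
Qed.

Lemma dual_norm_ge0 u : (0 < n)%N -> 0 <= dual_norm N u.
Proof.
move=> /is_norm_pos[x x0].
have := dotp_le_dual_norm u x; have := dotp_le_dual_norm u (- x).
rewrite is_normN dotpNr => h1 h2.
by rewrite -(pmulr_lge0 _ x0); lra.
Qed.

(** In dimension 0 every constant, even a negative one, satisfies [lipschitz_grad]; a vector of
    positive norm excludes this. *)
Lemma lipschitz_grad_ge0 F (l : R) : (0 < n)%N -> lipschitz_grad N F l -> 0 <= l.
Proof.
move=> n0 /[dup] lipF; have [x x0] := is_norm_pos n0.
move=> /(_ x 0); rewrite subr0 => H.
have := le_trans (dual_norm_ge0 _ n0) H.
by rewrite pmulr_lge0.
Qed.

End norms.

(** * Gradients and the descent lemma *)

Section gradient.
Context {R : realType} {n : nat}.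
Implicit Types (F : 'rV[R]_n -> R) (x w : 'rV[R]_n).

Lemma dotp_grad F x w : differentiable (F : 'rV[R]_n -> R^o) x ->
  'D_w (F : 'rV[R]_n -> R^o) x = dotp (grad F x) w.
Proof.
move=> dF; rewrite deriveE// {1}(row_sum_delta w) linear_sum /dotp.
by apply: eq_bigr => j _; rewrite linearZ /= mxE deriveE// mulrC.
Qed.

Lemma is_derive_line F x w (s : R) :
  differentiable (F : 'rV[R]_n -> R^o) (x + s *: w) ->
  is_derive s 1 (fun r : R => F (x + r *: w) : R^o)
    (dotp (grad F (x + s *: w)) w).
Proof.
move=> dF.
have := @diff_derivable _ _ _ _ _ w dF.
rewrite -(dotp_grad _ dF).
have E : (fun h : R => h^-1 *: ((F (h *: w + (x + s *: w)) : R^o)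
                                - F (x + s *: w)))
       = (fun h : R => h^-1 *: ((F (x + (h *: (1 : R^o) + s) *: w) : R^o)
                                - F (x + s *: w))).
  apply/funext => h; congr (_ *: (F _ - _)).
  have -> : h *: (1 : R^o) = h by exact: mulr1.
  by rewrite scalerDl addrCA.
move=> D; apply: DeriveDef; first by move: D; rewrite /derivable E.
by rewrite /derive E.
Qed.

Lemma fun_sumE (m : nat) (f : 'I_m -> 'rV[R]_n -> R^o) :
  (fun z => \sum_(i < m) f i z) = \sum_(i < m) f i.
Proof. by apply/funext => z; rewrite fct_sumE. Qed.

Lemma grad_sum (m : nat) (f : 'I_m -> 'rV[R]_n -> R) x :
  (forall i, differentiable (f i : 'rV[R]_n -> R^o) x) ->
  grad (fun z => \sum_(i < m) f i z) x = \sum_(i < m) grad (f i) x.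
Proof.
move=> df; apply/rowP => j; rewrite mxE summxE fun_sumE derive_sum.
  by apply: eq_bigr => i _; rewrite mxE.
by move=> i; exact: diff_derivable.
Qed.

Lemma differentiable_fun_sum (m : nat) (f : 'I_m -> 'rV[R]_n -> R) x :
  (forall i, differentiable (f i : 'rV[R]_n -> R^o) x) ->
  differentiable ((fun z => \sum_(i < m) f i z) : 'rV[R]_n -> R^o) x.
Proof. by move=> df; rewrite fun_sumE; exact: differentiable_sum. Qed.

Variable N : 'rV[R]_n -> R.
Hypothesis normN : is_norm N.

(** Along the segment, [F] minus its quadratic model has a nonpositive derivative by the Lipschitz
    bound; monotonicity takes the place of integrating the gradient. *)
Lemma descent F (l : R) x w :
  (forall z, differentiable (F : 'rV[R]_n -> R^o) z) -> lipschitz_grad N F l ->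
  F (x + w) <= F x + dotp (grad F x) w + l / 2 * N w ^+ 2.
Proof.
move=> dF lipF.
pose g (s : R) : R^o := F (x + s *: w) - (s * dotp (grad F x) w
                                          + s * s * (l / 2 * N w ^+ 2)).
pose g' (s : R) : R :=
  dotp (grad F (x + s *: w)) w - (dotp (grad F x) w + s * (l * N w ^+ 2)).
have dg (s : R) : is_derive s 1 g (g' s).
  have d1 := is_derive_line (dF (x + s *: w)).
  apply: is_derive_eq; rewrite /g' /GRing.scale /=.
  by field.
have := @ler0_derive1_nincr R g 0 1 _ _ _ 0 1 (lexx 0) ler01 (lexx 1).
rewrite /g scale1r scale0r addr0 !mul1r !mul0r addr0 subr0 => H.
suff : F (x + w) - (dotp (grad F x) w + l / 2 * N w ^+ 2) <= F x by lra.
apply: H => [s _|s|].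
- by have [] := dg s.
- rewrite in_itv /= => /andP[s0 s1]; rewrite derive1E (@derive_val _ _ _ _ _ _ _ (dg s)) /g'.
  have := dotp_le_dual_norm normN (grad F (x + s *: w) - grad F x) w.
  have := lipF (x + s *: w) x; rewrite [x + _]addrC addrK is_normZ// gtr0_norm//.
  move=> h1 h2.
  have := ler_wpM2r (is_norm_ge0 normN w) h1.
  by move: h2; rewrite !dotpE expr2 !mulrA; lra.
- by apply: derivable_within_continuous => s _; have [] := dg s.
Qed.

Lemma convex_lineE (X : set 'rV[R]_n) F : convex_function X F ->
  forall x y (t : R), X x -> X y -> 0 <= t <= 1 ->
    F (t *: x + (1 - t) *: y) <= t * F x + (1 - t) * F y.
Proof.
move=> cF x y t Xx Xy /andP[t0 t1].
by have := cF (Itv01 t0 t1) x y; rewrite !inE => /(_ Xx Xy).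
Qed.

Lemma convex_set_line (X : set 'rV[R]_n) : convex_set X ->
  forall x y (t : R), X x -> X y -> 0 <= t <= 1 -> X (t *: x + (1 - t) *: y).
Proof.
move=> cX x y t Xx Xy /andP[t0 t1].
by have := cX x y (Itv01 t0 t1); rewrite !inE => /(_ Xx Xy).
Qed.

End gradient.

(** Replaces the limit [t -> 0] after an inequality along a segment has been divided by [t]. If
    [a < 0], then [t = - a / (|b| + 1 - a)] is admissible and makes [a + t b] negative, since
    [b < |b| + 1 - a]. *)
Lemma ge0_affine_near0 {R : realType} (a b : R) :
  (forall t, 0 < t <= 1 -> 0 <= a + t * b) -> 0 <= a.
Proof.
move=> H; rewrite leNgt; apply/negP => a0.
have c0 : 0 < `|b| + 1 - a by have := normr_ge0 b; lra.
have := H (- a / (`|b| + 1 - a)).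
have nb := ler_norm b; have b0 := normr_ge0 b.
rewrite divr_gt0 ?oppr_gt0// ler_pdivrMr// => /(_ ltac:(lra)).
rewrite -(pmulr_lge0 _ c0) mulrDl mulrAC divfK ?gt_eqF//.
have : 0 <= - a * (`|b| - b) by rewrite mulr_ge0; lra.
have : 0 < a * a by rewrite nmulr_rgt0.
lra.
Qed.

(** * Bregman distances and prox steps *)

Section bregman.
Context {R : realType} {n : nat}.
Implicit Types (F : 'rV[R]_n -> R) (a b c w : 'rV[R]_n).

Definition bregman F a b : R := F a - F b - dotp (grad F b) (a - b).

Lemma bregmanxx F a : bregman F a a = 0.
Proof. by rewrite /bregman !subrr dotp0r subr0. Qed.

Lemma bregman3 F a b c : dotp (grad F c - grad F b) (b - a)
  = bregman F a c - bregman F b c - bregman F a b.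
Proof. by rewrite /bregman !dotpE; ring. Qed.

Lemma bregmanC F a b :
  dotp (grad F a - grad F b) (a - b) = bregman F a b + bregman F b a.
Proof. by rewrite /bregman !dotpE; ring. Qed.

Lemma bregman_sum (m : nat) (f : 'I_m -> 'rV[R]_n -> R) a b :
  (forall i z, differentiable (f i : 'rV[R]_n -> R^o) z) ->
  bregman (fun z => \sum_(i < m) f i z) a b = \sum_(i < m) bregman (f i) a b.
Proof.
move=> df; rewrite /bregman grad_sum; last by move=> i; exact: df.
by rewrite dotp_suml !sumrB.
Qed.

Variable N : 'rV[R]_n -> R.
Hypothesis normN : is_norm N.
Variables (F : 'rV[R]_n -> R) (l : R).
Hypothesis dF : forall z, differentiable (F : 'rV[R]_n -> R^o) z.
Hypothesis lipF : lipschitz_grad N F l.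

Lemma bregman_le a b : bregman F a b <= l / 2 * N (a - b) ^+ 2.
Proof.
have := descent normN b (a - b) dF lipF; rewrite addrC subrK /bregman; lra.
Qed.

Lemma gradN z : grad (fun y => - F y) z = - grad F z.
Proof.
apply/rowP => j; rewrite !mxE.
have -> : (fun y => - F y : R^o) = - (F : 'rV[R]_n -> R^o) by [].
by apply: deriveN; exact: diff_derivable.
Qed.

Lemma lipschitz_gradN : lipschitz_grad N (fun y => - F y) l.
Proof.
move=> a b; rewrite !gradN opprK addrC.
by rewrite (le_trans (lipF b a))// -opprB is_normN.
Qed.

Lemma descent_lower a w :
  F a + dotp (grad F a) w - l / 2 * N w ^+ 2 <= F (a + w).
Proof.
have dNF z : differentiable ((fun y => - F y) : 'rV[R]_n -> R^o) z.
  exact: differentiableN.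
have := descent normN a w dNF lipschitz_gradN.
rewrite gradN !dotpE; lra.
Qed.

Hypothesis cF : convex_function [set: 'rV[R]_n] F.

(* Convexity bounds the increment of [F] along [a - b] from above, smoothness
   bounds it from below up to a second-order term, which vanishes in the limit. *)
Lemma bregman_ge0 a b : 0 <= bregman F a b.
Proof.
apply: (@ge0_affine_near0 _ _ (l / 2 * N (a - b) ^+ 2)) => t /andP[t0 t1].
have := descent_lower b (t *: (a - b)).
have := convex_lineE cF (x := a) (y := b) (t := t) I I.
rewrite t1 ltW// => /(_ isT).
have -> : t *: a + (1 - t) *: b = b + t *: (a - b).
  by rewrite scalerBl scale1r scalerBr addrCA.
move=> h1 h2; have := le_trans h2 h1.
rewrite dotpZr (is_normZ normN) gtr0_norm// /bregman => h.
rewrite -(pmulr_rge0 _ t0); move: h; rewrite expr2.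
set u := dotp _ _; set z := N _; lra.
Qed.

(** At the trial point [a - lam w], convexity bounds [F] below by its linearization at [b] and
    smoothness bounds it above by the quadratic model at [a]. Comparing the two and dividing by
    [lam] gives the claim. *)
Lemma dotp_gradB_le a b w (lam : R) : 0 < lam ->
  dotp (grad F a - grad F b) w
  <= lam^-1 * bregman F a b + lam * (l / 2) * N w ^+ 2.
Proof.
move=> lam0.
have := descent normN a (- (lam *: w)) dF lipF.
have := bregman_ge0 (a - lam *: w) b.
rewrite (is_normN normN) (is_normZ normN) gtr0_norm// /bregman !dotpE => h1 h2.
rewrite -(ler_pM2l lam0) [leRHS]mulrDr [lam * (lam^-1 * _)]mulrA mulfV ?gt_eqF// mul1r.
move: h1 h2; rewrite !expr2.
set z := N w; lra.
Qed.

Lemma dotp_gradBC_le a b w (lam : R) : 0 < lam ->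
  dotp (grad F b - grad F a) w
  <= lam^-1 * bregman F a b + lam * (l / 2) * N w ^+ 2.
Proof.
by move=> /(dotp_gradB_le a b (- w)); rewrite dotpNr -dotpNl opprB is_normN.
Qed.

End bregman.

Section prox.
Context {R : realType} {n : nat}.
Variables (X : set 'rV[R]_n) (N : 'rV[R]_n -> R) (h omega : 'rV[R]_n -> R).
Hypothesis cX : convex_set X.
Hypothesis normN : is_norm N.
Hypothesis scw : strongly_convex X N 1 omega.
Implicit Types (x y z v g : 'rV[R]_n) (mu eta : R).

Lemma prox_funxx v x : prox_fun omega v x x = 0.
Proof. by rewrite /prox_fun subrr dotp0r addr0 subrr. Qed.

Lemma prox_fun_ge v x z : X x -> X z -> subdiff X omega x v ->
  N (z - x) ^+ 2 / 2 <= prox_fun omega v x z.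
Proof.
move=> Xx Xz sv; rewrite -subr_ge0.
apply: (@ge0_affine_near0 _ _ (N (z - x) ^+ 2 / 2)) => t /andP[t0 t1].
have t01 : 0 <= t <= 1 by rewrite t1 ltW.
have := scw Xz Xx t01; have := sv _ (convex_set_line cX Xz Xx t01).
have -> : t *: z + (1 - t) *: x - x = t *: (z - x).
  by rewrite scalerBl scale1r scalerBr addrCA addrAC subrr add0r.
move=> h1 h2; have := le_trans h1 h2.
rewrite dotpZr /prox_fun -(pmulr_rge0 _ t0).
set u := dotp _ _; set y := N _ ^+ 2; lra.
Qed.

Lemma prox_fun_ge0 v x z : X x -> X z -> subdiff X omega x v ->
  0 <= prox_fun omega v x z.
Proof.
move=> Xx Xz sv; apply: le_trans (prox_fun_ge Xx Xz sv).
by rewrite divr_ge0// sqr_ge0.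
Qed.

(** The optimality condition is combined with the subgradient inequality of [h]. The [omega] terms
    recombine exactly into prox-functions, which is how [mu] enters the coefficient at the new point
    and makes contraction possible. *)
Lemma prox_step_le mu g x0 v0 eta x1 v1 z :
  prox_step X h omega mu g x0 v0 eta x1 v1 -> X z ->
  dotp g x1 + h x1 + mu * omega x1 + eta * prox_fun omega v0 x0 x1
    + (mu + eta) * prox_fun omega v1 x1 z
  <= dotp g z + h z + mu * omega z + eta * prox_fun omega v0 x0 z.
Proof.
move=> [_ _ [h1 sh1 opt]] Xz; have := opt z Xz; have := sh1 z Xz.
by rewrite /prox_fun !dotpE; lra.
Qed.

(** Each candidate is tested at the other in the three-point inequality, and the sum forces their
    distance to vanish. Nothing is claimed about [v1] and [v1'], which may differ. *)
Lemma prox_step_uniq mu g x0 v0 eta x1 v1 x1' v1' : 0 < mu + eta ->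
  prox_step X h omega mu g x0 v0 eta x1 v1 ->
  prox_step X h omega mu g x0 v0 eta x1' v1' -> x1 = x1'.
Proof.
move=> me0 P1 P1'.
have [[Xx1 _] sv1 _] := P1; have [[Xx1' _] sv1' _] := P1'.
have := prox_step_le P1 Xx1'; have := prox_step_le P1' Xx1.
have := prox_fun_ge Xx1 Xx1' sv1.
rewrite -(ler_pM2l me0).
have : 0 <= (mu + eta) * prox_fun omega v1' x1' x1.
  by rewrite mulr_ge0 ?(ltW me0)// prox_fun_ge0.
move=> p0 p1 i1 i2.
have : (mu + eta) * N (x1' - x1) ^+ 2 <= 0 by lra.
rewrite pmulr_rle0// => sq0.
have : N (x1' - x1) ^+ 2 == 0 by rewrite eq_le sq0 sqr_ge0.
rewrite sqrf_eq0 => /eqP /(is_norm0_eq0 normN) /eqP.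
by rewrite subr_eq0 => /eqP.
Qed.

(** Near [xs], convexity controls the increment of [phi] and the descent lemma that of [F] up to
    second order. With [phi = h + mu omega] this is the nonnegativity of [lagrangian_gap]. *)
Lemma argmin_first_order (F phi : 'rV[R]_n -> R) (l : R) xs x :
  (forall z, differentiable (F : 'rV[R]_n -> R^o) z) -> lipschitz_grad N F l ->
  (forall y z (t : R), X y -> X z -> 0 <= t <= 1 ->
     phi (t *: y + (1 - t) *: z) <= t * phi y + (1 - t) * phi z) ->
  is_argmin X (fun z => F z + phi z) xs -> X x ->
  0 <= phi x - phi xs + dotp (grad F xs) (x - xs).
Proof.
move=> dF lipF cphi [Xxs opt] Xx.
apply: (@ge0_affine_near0 _ _ (l / 2 * N (x - xs) ^+ 2)) => t /andP[t0 t1].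
have t01 : 0 <= t <= 1 by rewrite t1 ltW.
have := opt _ (convex_set_line cX Xx Xxs t01).
have := cphi _ _ _ Xx Xxs t01.
have := descent normN xs (t *: (x - xs)) dF lipF.
have -> : xs + t *: (x - xs) = t *: x + (1 - t) *: xs.
  by rewrite scalerBl scale1r scalerBr addrCA.
rewrite dotpZr (is_normZ normN) gtr0_norm// -(pmulr_rge0 _ t0) !expr2.
set u := dotp _ _; set y := N _; lra.
Qed.

End prox.

(** * One step of the method *)

Section rpdg_step.
Context {R : realType} {n m : nat}.
Local Notation V := 'rV[R]_n.
Variables (X : set V) (N : V -> R) (f : 'I_m -> V -> R) (h omega : V -> R).
Variables (l p : 'I_m -> R) (mu eta tau alpha L : R) (xs : V).
Hypothesis cX : convex_set X.
Hypothesis normN : is_norm N.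
Hypothesis cf : forall i, convex_function [set: V] (f i).
Hypothesis df : forall i z, differentiable (f i : V -> R^o) z.
Hypothesis lipf : forall i, lipschitz_grad N (f i) (l i).
Hypothesis scw : strongly_convex X N 1 omega.
Hypothesis Xxs : X xs.
Hypothesis p0 : forall i, 0 < p i.
Hypothesis p_sum : \sum_i p i = 1.
Hypothesis l_le : forall i, l i <= 2 * L * p i.
Hypothesis L0 : 0 <= L.
Hypothesis eta0 : 0 <= eta.
Hypothesis tau0 : 0 < tau.
Hypothesis alpha01 : 0 <= alpha <= 1.
Hypothesis tau_eta : 8 * L <= tau * eta.
Hypothesis alpha_prox : eta <= alpha * (mu + eta).
Hypothesis alpha_dual : forall i, (1 + tau) * (1 - alpha) <= p i.

Let P := prox_fun omega.
Let B i := bregman (f i).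
Let Gs := \sum_i grad (f i) xs.

Definition ytilde (xu' xu : 'I_m -> V) i : V :=
  (p i)^-1 *: (grad (f i) (xu i) - grad (f i) (xu' i)) + grad (f i) (xu' i).

(* The primed arguments describe the previous iterate. *)
Definition lyapunov (x' v' x v : V) (xu' xu : 'I_m -> V) : R :=
  (mu + eta) * P v x xs + (1 + tau) * (\sum_i (p i)^-1 * B i (xu i) xs)
  - dotp (Gs - \sum_i ytilde xu' xu i) (x - x')
  + eta * P v' x' x + tau / 2 * (\sum_i (p i)^-1 * B i (xu' i) (xu i)).

(** The Lagrangian of the saddle-point form of the problem, with the dual variables frozen at
    [grad (f i) xs], relative to its value at [xs]. *)
Definition lagrangian_gap (z : V) : R :=
  h z + mu * omega z - (h xs + mu * omega xs) + dotp Gs (z - xs).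

Lemma p_le1 i : p i <= 1.
Proof.
rewrite -p_sum (bigD1 i)//= lerDl.
by apply: sumr_ge0 => j _; exact: ltW.
Qed.

Let B0 i a b : 0 <= B i a b.
Proof. by apply: (@bregman_ge0 _ _ N normN _ (l i)) => //; exact: df. Qed.

Let pB0 i a b : 0 <= (p i)^-1 * B i a b.
Proof. by rewrite mulr_ge0// invr_ge0 ltW. Qed.

(** The choice [lam = 2 / tau] leaves the quadratic coefficient [l i / tau], at most [p i * eta / 4]
    by [l_le] and [tau_eta], so the factor [1 / p i] cancels. Two such terms cost [eta / 2 N^2],
    which one [eta P] covers. *)
Lemma young_pinv i a b w :
  (p i)^-1 * `|dotp (grad (f i) b - grad (f i) a) w|
  <= tau / 2 * ((p i)^-1 * B i a b) + eta / 4 * N w ^+ 2.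
Proof.
have pi0 := p0 i; have lam0 : 0 < 2 / tau by rewrite divr_gt0.
have lp : l i <= p i * (eta / 4) * tau.
  by have := ler_wpM2l (ltW pi0) tau_eta; have := l_le i; lra.
have lamE : l i / tau = 2 / tau * (l i / 2) by field; rewrite gt_eqF.
have y1 := dotp_gradB_le normN (df i) (lipf i) (cf i) a b w lam0.
have y2 := dotp_gradBC_le normN (df i) (lipf i) (cf i) a b w lam0.
have y : `|dotp (grad (f i) b - grad (f i) a) w|
         <= tau / 2 * B i a b + l i / tau * N w ^+ 2.
  rewrite lamE /B; move: y1 y2.
  rewrite -[grad _ a - _]opprB dotpNl invf_div.
  move: (dotp _ _) (bregman _ _ _) => D b1 y1 y2.
  by rewrite ler_norml lerNl y1 y2.
have pV0 : 0 <= (p i)^-1 by rewrite invr_ge0 ltW.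
apply: (le_trans (ler_wpM2l pV0 y)); rewrite mulrDr lerD//; first by rewrite mulrCA.
by rewrite mulrA ler_wpM2r ?sqr_ge0// ler_pdivrMl// ler_pdivrMr.
Qed.

(** Since a single block moves, the quadratic term is paid once and not [m] times. The range of [c]
    admits both [1 / p i] and [1 / p i - 1], the coefficients in the two expansions of [ytilde]
    below. *)
Lemma dotp_single_le (c : 'I_m -> R) (xu' xu : 'I_m -> V) i0 w :
  (forall i, 0 <= c i <= (p i)^-1) -> (forall i, i != i0 -> xu' i = xu i) ->
  `|\sum_i c i * dotp (grad (f i) (xu i) - grad (f i) (xu' i)) w|
  <= tau / 2 * (\sum_i (p i)^-1 * B i (xu' i) (xu i)) + eta / 4 * N w ^+ 2.
Proof.
move=> c01 same.
rewrite (bigD1 i0)//= big1 ?addr0 => [|i ii0]; last first.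
  by rewrite same// subrr dotp0l mulr0.
have -> : \sum_i (p i)^-1 * B i (xu' i) (xu i)
        = (p i0)^-1 * B i0 (xu' i0) (xu i0).
  rewrite (bigD1 i0)//= big1 ?addr0// => i ii0.
  by rewrite same// /B bregmanxx mulr0.
rewrite normrM ger0_norm; last by have /andP[] := c01 i0.
apply: le_trans (young_pinv _ _ _ _).
by rewrite ler_wpM2r//; have /andP[] := c01 i0.
Qed.

Lemma ytilde_dotp (xu' xu : 'I_m -> V) w :
  dotp (\sum_i ytilde xu' xu i) w
  = dotp (\sum_i grad (f i) (xu' i)) w
    + \sum_i (p i)^-1 * dotp (grad (f i) (xu i) - grad (f i) (xu' i)) w.
Proof.
rewrite !dotp_suml -big_split; apply: eq_bigr => i _ /=.
by rewrite /ytilde [LHS]dotpDl dotpZl addrC.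
Qed.

Lemma ytilde_dotp_new (xu' xu : 'I_m -> V) w :
  dotp (\sum_i ytilde xu' xu i) w
  = dotp (\sum_i grad (f i) (xu i)) w
    + \sum_i ((p i)^-1 - 1) * dotp (grad (f i) (xu i) - grad (f i) (xu' i)) w.
Proof.
rewrite !dotp_suml -big_split; apply: eq_bigr => i _ /=.
by rewrite /ytilde !dotpE; ring.
Qed.

Let pinv01 i : 0 <= (p i)^-1 - 1 <= (p i)^-1.
Proof.
rewrite lerBlDr lerDl ler01 andbT subr_ge0.
by rewrite -invr1 lef_pV2 ?posrE// p_le1.
Qed.

Let pinvp i : 0 <= (p i)^-1 <= (p i)^-1.
Proof. by rewrite lexx invr_ge0 ltW. Qed.

(** The cross term splits into the dual errors of all blocks, charged to the [B i (xu i) xs], and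
    the one-block residual of [ytilde], charged to the [tau / 2] reserve. Each also costs
    [eta / 4 N^2], together no more than [eta P v' x' x]. *)
Lemma lyapunov_ge (x' v' x v : V) xu' xu i0 : X x' -> X x -> subdiff X omega x' v' ->
  (forall i, i != i0 -> xu' i = xu i) ->
  (mu + eta) * P v x xs <= lyapunov x' v' x v xu' xu.
Proof.
move=> Xx' Xx sv' same.
have Pge := ler_wpM2l eta0 (prox_fun_ge cX scw Xx' Xx sv').
have res := dotp_single_le (x - x') pinv01 same.
have tau1 : 0 < 1 + tau by rewrite addr_gt0.
have lead : dotp (\sum_i (grad (f i) xs - grad (f i) (xu i))) (x - x')
   <= (1 + tau) * (\sum_i (p i)^-1 * B i (xu i) xs) + eta / 4 * N (x - x') ^+ 2.
  apply: (@le_trans _ _ (\sum_i ((1 + tau) * ((p i)^-1 * B i (xu i) xs)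
            + p i * (eta / 4 * N (x - x') ^+ 2)))); last first.
    by rewrite big_split/= -mulr_sumr -mulr_suml p_sum mul1r.
  rewrite dotp_suml; apply: ler_sum => i _.
  (* This parameter reproduces the weight [(1 + tau) / p i] exactly; its factor [p i] turns the
     quadratic terms into an average, so that they add up to [eta / 4 N^2]. *)
  have lam0 : 0 < p i / (1 + tau) by rewrite divr_gt0.
  apply: (le_trans (dotp_gradBC_le normN (df i) (lipf i) (cf i) _ _ _ lam0)).
  rewrite invf_div; apply: lerD; first by rewrite -mulrA.
  rewrite [leRHS]mulrA ler_wpM2r ?sqr_ge0// -mulrA.
  rewrite ler_wpM2l ?(ltW (p0 i))// ler_pdivrMl//.
  have := l_le i; have := p_le1 i; have := mulr_ge0 (ltW tau0) eta0.
  have : 2 * L * p i <= 2 * L by rewrite ler_piMr ?mulr_ge0// p_le1.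
  have := tau_eta; have := eta0.
  lra.
move: lead res; rewrite sumrB -/Gs /lyapunov !dotpDl !dotpNl ytilde_dotp_new -/P in Pge *.
rewrite ler_norml => lead /andP[res _].
lra.
Qed.

(** Valid for each draw. With [g] the new estimate, the three-point inequality at [xs] produces
    [<Gs - g, x1 - xs>]. The cross term of the new [lyapunov] replaces [x1] by [x], and the
    extrapolation replaces [x] by [xt] at the price of [- alpha <Gs - g, x - x'>], the old cross
    term up to the change of estimate. *)
Lemma rpdg_step_path (x' v' x v : V) xu' xu i0 xu1 x1 v1 i1 :
  let xt := alpha *: (x - x') + x in
  X x' -> X x -> subdiff X omega x' v' ->
  (forall i, i != i0 -> xu' i = xu i) -> (forall i, i != i1 -> xu i = xu1 i) ->
  prox_step X h omega mu (\sum_i ytilde xu xu1 i) x v eta x1 v1 ->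
  lagrangian_gap x1 + lyapunov x v x1 v1 xu xu1
  <= dotp (Gs - \sum_i ytilde xu xu1 i) (xt - xs)
     + (1 + tau) * (\sum_i (p i)^-1 * B i (xu1 i) xs)
     + tau * (\sum_i (p i)^-1 * B i (xu i) (xu1 i))
     + eta * P v x xs
     + alpha * (- dotp (Gs - \sum_i ytilde xu' xu i) (x - x')
                + tau / 2 * (\sum_i (p i)^-1 * B i (xu' i) (xu i))
                + eta * P v' x' x).
Proof.
move=> xt Xx' Xx sv' same same1 step.
have /andP[alpha0 alpha1] := alpha01.
have Pge := ler_wpM2l eta0 (prox_fun_ge cX scw Xx' Xx sv').
have res := lerNnormlW (dotp_single_le (x - x') pinv01 same).
have res1 := ler_normlW (dotp_single_le (x - x') pinvp same1).
(* Expanding the later estimate around its old gradients and the earlier one around its new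
   gradients cancels the gradients at [xu]; one block of each remains. *)
have diff : alpha * (dotp (\sum_i ytilde xu xu1 i) (x - x')
                     - dotp (\sum_i ytilde xu' xu i) (x - x'))
  <= alpha * (tau / 2 * (\sum_i (p i)^-1 * B i (xu' i) (xu i))
    + tau / 2 * (\sum_i (p i)^-1 * B i (xu i) (xu1 i)) + eta * P v' x' x).
  rewrite ler_wpM2l// ytilde_dotp ytilde_dotp_new.
  move: Pge res res1; rewrite -/P.
  lra.
clear Pge res res1.
have three := prox_step_le step Xxs.
have B1 : 0 <= \sum_i (p i)^-1 * B i (xu i) (xu1 i) by apply: sumr_ge0.
have aB1 : alpha * (tau / 2 * (\sum_i (p i)^-1 * B i (xu i) (xu1 i)))
           <= tau / 2 * (\sum_i (p i)^-1 * B i (xu i) (xu1 i)).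
  by rewrite ler_piMl// mulr_ge0// divr_ge0// ltW.
move: aB1 diff three; clear B1; rewrite /lagrangian_gap /lyapunov -/P {}/xt.
move: (\sum_i ytilde _ _ _) (\sum_i ytilde _ _ _) (x - x') => g g' w.
move: (\sum_i _) (\sum_i _) (\sum_i _) => S1 S2 S3.
move: (P _ _ _) (P _ _ _) (P _ _ _) (P _ _ _) => P1 P2 P3 P4.
move: (h _) (h _) (omega _) (omega _) => h1 h2 o1 o2.
move: Gs => G.
rewrite !dotpE.
move: (dotp _ _) (dotp _ _) (dotp _ _) (dotp _ _) (dotp _ _) (dotp _ _).
move=> d1 d2 d3 d4 d5 d6.
lra.
Qed.

Lemma avg_if (c d : 'I_m -> R) :
  \sum_j p j * (\sum_i (if i == j then c i else d i))
  = \sum_i (p i * c i + (1 - p i) * d i).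
Proof.
transitivity (\sum_j p j * (\sum_i d i + (c j - d j))).
  apply: eq_bigr => j _; congr (_ * _).
  rewrite (bigD1 j)//= eqxx [in RHS](bigD1 j)//=.
  under eq_bigr => i /negbTE-> do [].
  by ring.
under eq_bigr do rewrite mulrDr.
rewrite big_split/= -mulr_suml p_sum mul1r -big_split/=.
by apply: eq_bigr => i _; ring.
Qed.

Lemma rpdg_step (x' v' x v : V) (xu' xu : 'I_m -> V) i0
    (xu1 : 'I_m -> 'I_m -> V) (x1 v1 : 'I_m -> V) :
  let xt := alpha *: (x - x') + x in
  X x' -> X x -> subdiff X omega x' v' -> subdiff X omega x v ->
  (forall i, i != i0 -> xu' i = xu i) ->
  (forall j i, xu1 j i = if i == j then (1 + tau)^-1 *: (xt + tau *: xu i)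
                         else xu i) ->
  (forall j, prox_step X h omega mu (\sum_i ytilde xu (xu1 j) i) x v eta
               (x1 j) (v1 j)) ->
  \sum_j p j * (lagrangian_gap (x1 j) + lyapunov x v (x1 j) (v1 j) xu (xu1 j))
  <= alpha * lyapunov x' v' x v xu' xu.
Proof.
move=> xt Xx' Xx sv' sv same xu1E step.
have /andP[alpha0 alpha1] := alpha01.
have tau1 : 0 < 1 + tau by rewrite addr_gt0.
(* [xh i] is where block [i] moves if drawn; [c i] and [d i] are its contributions to the pathwise
   bound when it is drawn and when it is not; [A] is inherited from the previous step. *)
pose xh i := (1 + tau)^-1 *: (xt + tau *: xu i).
pose A := - dotp (Gs - \sum_i ytilde xu' xu i) (x - x')
          + tau / 2 * (\sum_i (p i)^-1 * B i (xu' i) (xu i)) + eta * P v' x' x.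
pose c i := dotp (grad (f i) xs - ytilde xu xh i) (xt - xs)
  + (1 + tau) * ((p i)^-1 * B i (xh i) xs) + tau * ((p i)^-1 * B i (xu i) (xh i)).
pose d i := dotp (grad (f i) xs - grad (f i) (xu i)) (xt - xs)
  + (1 + tau) * ((p i)^-1 * B i (xu i) xs).
apply: (@le_trans _ _ (\sum_j p j * (\sum_i (if i == j then c i else d i)
                                     + (eta * P v x xs + alpha * A)))).
  apply: ler_sum => j _; rewrite ler_wpM2l ?(ltW (p0 j))//.
  have same1 i : i != j -> xu i = xu1 j i by rewrite xu1E => /negbTE->.
  apply: (le_trans (rpdg_step_path Xx' Xx sv' same same1 (step j))).
  rewrite -/A -[leLHS]addrA lerD2r -sumrB dotp_suml !mulr_sumr -!big_split/=.
  apply: ler_sum => i _; rewrite /ytilde xu1E.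
  case: eqP => _; first by rewrite /c /ytilde.
  by rewrite subrr scaler0 add0r /B bregmanxx !mulr0 addr0.
under eq_bigr do rewrite mulrDr.
rewrite big_split/= -mulr_suml p_sum mul1r avg_if.
have cd i : p i * c i + (1 - p i) * d i
            <= alpha * ((1 + tau) * ((p i)^-1 * B i (xu i) xs)).
  have xhE : (1 + tau) *: xh i = xt + tau *: xu i.
    by rewrite /xh scalerA mulfV ?scale1r// gt_eqF.
  (* The averaging rule for the underlined points, solved for [xt]; it gives the inner product the
     two shapes needed by [bregman3] and [bregmanC]. *)
  have uE : xt - xs = tau *: (xh i - xu i) + (xh i - xs).
    have -> : xt = (1 + tau) *: xh i - tau *: xu i by rewrite xhE addrK.
    rewrite scalerDl scale1r scalerBr addrA; congr (_ - xs).
    by rewrite -addrA addrC.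
  have pn0 : p i != 0 by rewrite gt_eqF.
  have := ler_wpM2r (pB0 i (xu i) xs) (alpha_dual i).
  rewrite mulVKf// => dualstep.
  have := bregman3 (f i) (xu i) (xh i) xs.
  have := bregmanC (f i) (xh i) xs.
  have := B0 i xs (xh i).
  rewrite /c /d /ytilde uE -/(B i _ _).
  move: dualstep; rewrite -![bregman (f i) _ _]/(B i _ _).
  move: (B i _ _) (B i _ _) (B i _ _) (B i _ _) => b1 b2 b3 b4.
  move: (xh i - xu i) (xh i - xs) => u1 u2.
  move: (grad (f i) xs) (grad (f i) (xh i)) (grad (f i) (xu i)) => gs gh gx.
  rewrite !dotpE.
  move: (dotp gs u1) (dotp gs u2) (dotp gh u1) (dotp gh u2) (dotp gx u1) (dotp gx u2).
  move=> s1 s2 h1 h2 g1 g2 dualstep b30 e1 e2.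
  (* Unbiasedness: averaging turns [ytilde] into the gradient at [xh i]. After the Bregman
     identities the terms at [xh i] cancel up to [- B i xs (xh i)], and [- B i (xu i) xs] survives;
     by [alpha_dual] the latter yields the factor [alpha]. *)
  rewrite [leLHS](_ : _ = tau * (s1 - h1) - (h2 - s2) + (1 + tau) * b2 + tau * b1
      + (1 + tau) * ((p i)^-1 * b4) - (1 + tau) * b4); last by field.
  by rewrite e1 e2; move: dualstep b30; move: (_^-1 * _) => b5; lra.
have dual : \sum_i (p i * c i + (1 - p i) * d i)
            <= alpha * ((1 + tau) * \sum_i (p i)^-1 * B i (xu i) xs).
  by rewrite !mulr_sumr; apply: ler_sum => i _; exact: cd.
have := ler_wpM2r (prox_fun_ge0 cX scw Xx Xxs sv) alpha_prox.
move: dual; rewrite /A /lyapunov -/P.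
move: (\sum_i _) (\sum_i _) (\sum_i _) => S1 S2 S3.
move: (dotp _ _) (P _ _ _) (P _ _ _) => D P1 P2.
lra.
Qed.

End rpdg_step.

(** * Index sequences as random words *)

Section words.
Context {R : realType} {m k : nat}.
Variable p : 'I_m -> R.
Local Notation word := {ffun 'I_k -> 'I_m}.
Implicit Types (s : word) (t : 'I_k).

Definition weight s : R := \prod_t p (s t).

Definition mean (G : word -> R) : R := \sum_s weight s * G s.

Definition redraw s t (j : 'I_m) : word :=
  [ffun u => if u == t then j else s u].

Lemma redraw_eq s t j : redraw s t j t = j.
Proof. by rewrite ffunE eqxx. Qed.

Lemma redraw_neq s t j u : u != t -> redraw s t j u = s u.
Proof. by move=> /negbTE ut; rewrite ffunE ut. Qed.

Hypothesis p_ge0 : forall j, 0 <= p j.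
Hypothesis p_sum : \sum_j p j = 1.

Lemma weight_ge0 s : 0 <= weight s.
Proof. by apply: prodr_ge0. Qed.

Lemma weight_sum : \sum_s weight s = 1.
Proof.
rewrite /weight -(bigA_distr_bigA (fun _ : 'I_k => p))/=.
by apply: big1 => t _.
Qed.

Lemma mean_cst c : mean (fun=> c) = c.
Proof. by rewrite /mean -mulr_suml weight_sum mul1r. Qed.

Lemma meanD G H : mean (fun s => G s + H s) = mean G + mean H.
Proof. by rewrite /mean -big_split; apply: eq_bigr => s _; rewrite mulrDr. Qed.

Lemma meanZ c G : mean (fun s => c * G s) = c * mean G.
Proof. by rewrite /mean mulr_sumr; apply: eq_bigr => s _; rewrite mulrCA. Qed.

Lemma mean_sum (r : seq nat) (G : nat -> word -> R) :
  mean (fun s => \sum_(t <- r) G t s) = \sum_(t <- r) mean (G t).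
Proof.
rewrite /mean exchange_big/=; apply: eq_bigr => s _.
by rewrite mulr_sumr.
Qed.

Lemma le_mean G H : (forall s, G s <= H s) -> mean G <= mean H.
Proof. by move=> GH; apply: ler_sum => s _; rewrite ler_wpM2l// weight_ge0. Qed.

(* Swapping the [t]-th letter of [s] with an independent letter [j] is an
   involution on pairs [(s, j)] that preserves their joint weight. *)
Lemma mean_redraw t (G : word -> R) :
  mean G = mean (fun s => \sum_j p j * G (redraw s t j)).
Proof.
pose sw (q : word * 'I_m) := (redraw q.1 t q.2, q.1 t).
have swK : involutive sw.
  move=> [s j]; rewrite /sw /= redraw_eq; congr pair.
  by apply/ffunP => u; rewrite !ffunE; case: eqP => [->|].
have sw_weight q : weight (sw q).1 * p (sw q).2 = weight q.1 * p q.2.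
  rewrite /weight /sw /= (bigD1 t)//= redraw_eq [in RHS](bigD1 t)//=.
  rewrite (eq_bigr (fun u => p (q.1 u))); first by ring.
  by move=> u ut; rewrite redraw_neq.
transitivity (\sum_(q : word * 'I_m) weight q.1 * p q.2 * G q.1).
  rewrite -(pair_bigA _ (fun s j => weight s * p j * G s))/=.
  apply: eq_bigr => s _; rewrite -mulr_suml -mulr_sumr p_sum mulr1//.
rewrite (reindex_inj (inv_inj swK)) /mean.
rewrite -(pair_bigA _ (fun s j => weight (sw (s, j)).1 * p (sw (s, j)).2
                                  * G (sw (s, j)).1))/=.
apply: eq_bigr => s _; rewrite mulr_sumr; apply: eq_bigr => j _.
by rewrite (sw_weight (s, j)) mulrA.
Qed.

End words.

Section word_law.
Context {R : realType} {d : measure_display} {T : measurableType d}.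
Variables (Pr : probability T R) (m k : nat) (p : 'I_m -> R).
Variable I : nat -> T -> 'I_m.
Hypothesis iidI : iid_indices Pr k p I.
Local Notation word := {ffun 'I_k -> 'I_m}.

(** Draws are numbered from 1 and letters from 0, so letter [t] is the draw of iteration [t.+1]. *)
Definition word_of (a : T) : word := [ffun t : 'I_k => I t.+1 a].

Lemma word_ofE (s : word) : word_of @^-1` [set s]
  = \bigcap_(t in [set` iota 1 k])
      I t @^-1` [set j | forall u : 'I_k, u.+1 = t -> j = s u].
Proof.
apply/seteqP; split => a /=.
  by move=> <- t _ u <-; rewrite ffunE.
move=> H; apply/ffunP => u; rewrite ffunE.
by apply: (H u.+1) => //=; rewrite mem_iota add1n !ltnS ltn_ord.
Qed.

Lemma letter_set (s : word) (u : 'I_k) :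
  [set j | forall v : 'I_k, v.+1 = u.+1 -> j = s v] = [set s u].
Proof.
apply/seteqP; split => j /=; first by apply.
by move=> -> v [] /ord_inj ->.
Qed.

Lemma measurable_word (s : word) : measurable (word_of @^-1` [set s]).
Proof.
case: iidI => mI _ _; rewrite word_ofE bigcap_seq big_seq.
apply: bigsetI_measurable => t; rewrite mem_iota add1n ltnS; exact: mI.
Qed.

Lemma prob_word (s : word) : Pr (word_of @^-1` [set s]) = (weight p s)%:E.
Proof.
case: iidI => mI lawI indI.
rewrite word_ofE indI ?iota_uniq//; last first.
  by move=> t; rewrite mem_iota add1n ltnS.
rewrite (_ : iota 1 k = index_iota 1 k.+1); last by rewrite /index_iota subn1.
rewrite big_add1/= big_mkord /weight.
rewrite -prodEFin.
apply: eq_bigr => u _; rewrite letter_set.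
by rewrite -(lawI u.+1 (s u)) ?ltn_ord.
Qed.

(* Hence an expectation of nonanticipating quantities is a finite weighted sum
   of their values at one representative sample point per word. *)
Lemma word_of_surj : (forall j, 0 < p j) -> forall s, exists a, word_of a = s.
Proof.
move=> p0 s; apply/not_existsP => H.
have : Pr (word_of @^-1` [set s]) = 0%E.
  by rewrite (_ : _ @^-1` _ = set0) ?measure0//; apply/seteqP; split.
rewrite prob_word => -[] /eqP.
by rewrite gt_eqF// prodr_gt0.
Qed.

Lemma measurable_word_fun (g : word -> R) : measurable_fun setT (g \o word_of).
Proof.
move=> _ Y _; rewrite setTI.
have -> : (g \o word_of) @^-1` Y
        = \bigcup_(s in [set s | Y (g s)]) word_of @^-1` [set s].
  apply/seteqP; split => a /=; first by exists (word_of a).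
  by case=> s /= Ys sa; rewrite sa.
apply: fin_bigcup_measurable => [|s _]; last exact: measurable_word.
exact: finite_finset.
Qed.

Lemma expectation_word (g : word -> R) : (forall s, 0 <= g s) ->
  ('E_Pr[g \o word_of] = (mean p g)%:E)%E.
Proof.
move=> g0; rewrite unlock.
transitivity (\int[Pr]_a \sum_(s <- enum word)
    (g s * \1_(word_of @^-1` [set s]) a)%:E)%E.
  apply: eq_integral => a _ /=; rewrite big_enum /= sumEFin; congr EFin.
  rewrite (bigD1 (word_of a))//= indicE mem_set// mulr1 big1 ?addr0// => s.
  by rewrite indicE eq_sym => /eqP sa; rewrite memNset ?mulr0.
rewrite ge0_integral_sum//.
- rewrite big_enum/= /mean -sumEFin; apply: eq_bigr => s _.
  rewrite (integralZl_indic measurableT (fun=> word_of @^-1` [set s])).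
  + rewrite integral_indic//; last exact: measurable_word.
    by rewrite setIT [X in (_ * X)%E](prob_word s) EFinM muleC.
  + by move=> /lt_geF; rewrite g0.
  + exact: measurable_word.
- move=> s; apply/measurable_EFinP; apply: measurable_funM => //.
  by apply: measurable_indic; exact: measurable_word.
- by move=> s a _; rewrite lee_fin mulr_ge0.
Qed.

End word_law.

(** Markov's inequality, applied to the complementary event [eps < G]. *)
Lemma prob_le_of_expectation {R : realType} {d : measure_display}
    {T : measurableType d} (Pr : probability T R) (G : T -> R) (eps lambda : R) :
  measurable_fun setT G -> (forall a, 0 <= G a) -> 0 < eps ->
  ('E_Pr[G] <= (lambda * eps)%:E)%E ->
  ((1 - lambda)%:E <= Pr [set a | (G a <= eps)%R])%E.
Proof.
move=> mG G0 eps0; rewrite unlock => EG.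
pose A := [set a | (eps < G a)%R].
have mA : measurable A.
  have -> : A = setT `&` G @^-1` `]eps, +oo[.
    by apply/seteqP; split => a /=; rewrite in_itv/= andbT => // -[].
  exact: mG.
have -> : [set a | (G a <= eps)%R] = ~` A.
  by apply/seteqP; split => a /=; rewrite leNgt => /negP.
rewrite probability_setC// EFinB leeB//.
rewrite -(@lee_pmul2r _ eps%:E)// -EFinM.
apply: le_trans EG; rewrite muleC -(integral_cst Pr mA eps%:E).
apply: (@le_trans _ _ (\int[Pr]_(a in A) (G a)%:E)%E).
  apply: ge0_le_integral => //.
  - by move=> a _; rewrite lee_fin ltW.
  - by apply/measurable_EFinP; exact: measurable_funS mG.
  - by move=> a /= /ltW; rewrite lee_fin.
apply: ge0_subset_integral => //; first exact/measurable_EFinP.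
by move=> a _; rewrite lee_fin.
Qed.

(** * Sample paths *)

Section path.
Context {R : realType} {n m : nat}.
Local Notation V := 'rV[R]_n.
Variables (X : set V) (N : V -> R) (f : 'I_m -> V -> R) (h omega : V -> R).
Variables (p : 'I_m -> R) (mu eta tau alpha : R) (x0 v0 : V) (k : nat).
Local Notation is_path := (rpdg_path X f h omega mu p
  (fun=> tau) (fun=> eta) (fun=> alpha) x0 v0 k).

Section one_path.
Variables (i : nat -> 'I_m) (x v : nat -> V) (xu y yt : nat -> 'I_m -> V).
Hypothesis path : is_path i x v xu y yt.

Lemma rpdg_xuE t j : (t < k)%N ->
  xu t.+1 j = if j == i t.+1 then
    (1 + tau)^-1 *: (alpha *: (x t - x t.-1) + x t + tau *: xu t j)
  else xu t j.
Proof.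
move=> tk; case: eqVneq => [->|jt]; first by rewrite (rpdg_xu path tk).
by have [] := rpdg_other path tk jt.
Qed.

Lemma rpdg_yE t j : (t <= k)%N -> y t j = grad (f j) (xu t j).
Proof.
elim: t j => [|t IH] j tk; first by rewrite (rpdg_y0 path) (rpdg_xu0 path).
have [->|jt] := eqVneq j (i t.+1); first exact: (rpdg_y path tk).
by have [-> -> _] := rpdg_other path tk jt; rewrite IH// ltnW.
Qed.

(** For an index that is not drawn the underlined point stays put and the correction in [ytilde]
    vanishes, so one formula covers all blocks. *)
Lemma rpdg_ytE t j : (t < k)%N -> yt t.+1 j = ytilde f p (xu t) (xu t.+1) j.
Proof.
move=> tk; rewrite /ytilde -!rpdg_yE//; last exact: ltnW.
have [->|jt] := eqVneq j (i t.+1); first exact: (rpdg_yt path tk).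
have [_ -> ->] := rpdg_other path tk jt.
by rewrite subrr scaler0 add0r.
Qed.

Lemma rpdg_stepE t : (t < k)%N ->
  prox_step X h omega mu (\sum_j ytilde f p (xu t) (xu t.+1) j) (x t) (v t) eta
    (x t.+1) (v t.+1).
Proof.
move=> tk; have := rpdg_prox path tk.
by rewrite (eq_bigr _ (fun j _ => rpdg_ytE j tk)).
Qed.

Hypothesis Xx0 : X x0.
Hypothesis sv0 : subdiff X omega x0 v0.

Lemma rpdg_in t : (t <= k)%N -> X (x t) /\ subdiff X omega (x t) (v t).
Proof.
case: t => [|t] tk; first by rewrite (rpdg_x0 path) (rpdg_v0 path).
by have [[]] := rpdg_stepE tk.
Qed.

End one_path.

Hypothesis cX : convex_set X.
Hypothesis normN : is_norm N.
Hypothesis scw : strongly_convex X N 1 omega.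
Hypothesis me0 : 0 < mu + eta.

(** Induction through the uniqueness of the prox point. Agreement of the selected subgradients is
    assumed because the prox step does not determine them, and [t.-1] is carried along because the
    extrapolation looks two iterates back. *)
Lemma rpdg_determined i x v xu y yt i' x' v' xu' y' yt' :
  is_path i x v xu y yt -> is_path i' x' v' xu' y' yt' ->
  forall t, (t <= k)%N ->
  (forall s, (0 < s <= t)%N -> i s = i' s) ->
  (forall s, (s <= t)%N -> v s = v' s) ->
  [/\ x t = x' t, x t.-1 = x' t.-1 & xu t = xu' t].
Proof.
move=> path path'; elim=> [|t IH] tk ii' vv'.
  rewrite (rpdg_x0 path) (rpdg_x0 path'); split => //.
  by apply/funext => j; rewrite (rpdg_xu0 path) (rpdg_xu0 path').
have [||e1 e2 e3] := IH (ltnW tk).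
- by move=> s /andP[s0 st]; rewrite ii'// s0 ltnW.
- by move=> s st; rewrite vv'// ltnW.
have e4 : xu t.+1 = xu' t.+1.
  apply/funext => j; rewrite (rpdg_xuE path _ tk) (rpdg_xuE path' _ tk).
  by rewrite e1 e2 e3 ii'//= leqnn.
split => //.
have := rpdg_stepE path tk; have := rpdg_stepE path' tk.
rewrite -e1 -e3 -e4 -(vv' t)// => s1 s2.
exact: (prox_step_uniq cX normN scw me0 s2 s1).
Qed.

End path.

(** * Averages and scalar estimates *)

(** A quantity determined by the draws factors through [word_of], which has finitely many values and
    measurable fibres. This yields measurability without any assumption on the iterates. *)
Lemma factor_expectation {R : realType} {d : measure_display}
    {T : measurableType d} (Pr : probability T R) (m k : nat) (p : 'I_m -> R)
    (I : nat -> T -> 'I_m) (rho : {ffun 'I_k -> 'I_m} -> T) (G : T -> R) :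
  iid_indices Pr k p I -> (forall s, word_of k I (rho s) = s) ->
  (forall a b, (forall s, (0 < s <= k)%N -> I s a = I s b) -> G a = G b) ->
  (forall a, 0 <= G a) ->
  measurable_fun setT G /\ ('E_Pr[G] = (mean p (G \o rho))%:E)%E.
Proof.
move=> iidI rhoK GI G0.
have -> : G = (G \o rho) \o word_of k I.
  apply/funext => a /=; apply: GI => -[//|s] /= sk.
  have /(congr1 (fun q : {ffun 'I_k -> 'I_m} => q (Ordinal sk))) := rhoK (word_of k I a).
  by rewrite !ffunE.
split; first exact: (measurable_word_fun iidI).
rewrite (expectation_word iidI); last by move=> s; exact: G0.
congr (_%:E); apply: eq_bigr => s _ /=.
by rewrite rhoK.
Qed.

(** Jensen's inequality by induction: the next point joins the previous average with weight
    [c k.+2 / (W + c k.+2)]. Membership in [X] is proved alongside, since convexity of [F] is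
    available on [X] only. *)
Lemma weighted_average_convex {R : realType} {V : lmodType R} (X : set V)
    (F : V -> R) (c : nat -> R) (z : nat -> V) (k : nat) :
  (forall y y' (t : R), X y -> X y' -> 0 <= t <= 1 ->
    X (t *: y + (1 - t) *: y')
    /\ F (t *: y + (1 - t) *: y') <= t * F y + (1 - t) * F y') ->
  (forall t, 0 < c t) -> (forall t, (t <= k)%N -> X (z t)) -> (0 < k)%N ->
  let W := \sum_(1 <= t < k.+1) c t in
  let zbar := W^-1 *: \sum_(1 <= t < k.+1) c t *: z t in
  X zbar /\ F zbar <= W^-1 * \sum_(1 <= t < k.+1) c t * F (z t).
Proof.
move=> XF c0; case: k => // k Xz _; elim: k Xz => [|k IH] Xz W zbar.
  rewrite /zbar /W !big_nat1 scalerA mulrA mulVf ?gt_eqF// scale1r mul1r.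
  by split => //; exact: Xz.
rewrite {}/zbar {}/W big_nat_recr//= [X in _ *: X]big_nat_recr//=.
rewrite [X in _ * X]big_nat_recr//=.
have [t tk|] := IH; first by apply: Xz; exact: leqW.
set W := \sum_(1 <= t < k.+2) c t.
set Z := \sum_(1 <= t < k.+2) c t *: z t.
set FZ := \sum_(1 <= t < k.+2) c t * F (z t) => XW FW.
have W0 : 0 < W.
  rewrite /W big_nat_recr//= ltr_wpDl//; apply: sumr_ge0 => t _; exact: ltW.
have Wc0 : 0 < W + c k.+2 by rewrite addr_gt0.
have cE : 1 - W / (W + c k.+2) = c k.+2 / (W + c k.+2) by field; rewrite gt_eqF.
have t01 : 0 <= W / (W + c k.+2) <= 1.
  by rewrite divr_ge0 ?(ltW W0) ?(ltW Wc0)// ler_pdivrMr// mul1r lerDl ltW.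
have [] := XF _ (z k.+2) _ XW (Xz _ (leqnn _)) t01.
rewrite cE scalerA mulrAC mulfV ?gt_eqF// mul1r.
rewrite [in c _ / _ *: _]mulrC -scalerA -scalerDr => X1 F1; split => //.
apply: (le_trans F1).
rewrite ![_ / (W + c k.+2)]mulrC -!mulrA -mulrDr.
rewrite ler_wpM2l ?invr_ge0 ?(ltW Wc0)// lerD2r.
by rewrite -ler_pdivlMl.
Qed.

Lemma sum_geometric {R : realType} (alpha M : R) (k : nat) :
  alpha != 0 -> M != 0 -> alpha = 1 - M^-1 ->
  \sum_(1 <= t < k.+1) alpha ^- t = M * (alpha ^- k - 1).
Proof.
move=> a0 M0 aE; elim: k => [|k IH].
  by rewrite big_geq// expr0 invr1 subrr mulr0.
rewrite big_nat_recr//= IH exprS invfM.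
have Ma : M * alpha = M - 1 by rewrite aE; field.
have := mulVKf a0 (alpha ^- k); move: (alpha^-1 * _) => u <-.
by rewrite mulrBr mulrA Ma; ring.
Qed.

(** The right-hand side grows by at least [(1 - a) (a^-k + a^k)] per step, and
    [a^-k + a^k >= 2 >= 1 + a]. Applied to the square root of [alpha], it lets a factor [k] be
    absorbed at the cost of halving the exponent. *)
Lemma geometric_gap {R : realType} (a : R) (k : nat) : 0 < a <= 1 ->
  k%:R * (1 - a ^+ 2) <= a ^- k - a ^+ k.
Proof.
move=> /andP[a0 a1]; elim: k => [|k IH].
  by rewrite mul0r expr0 invr1 subrr.
have ak0 : 0 < a ^+ k by rewrite exprn_gt0.
have ak1 : a ^+ k <= 1 by rewrite exprn_ile1// ltW.
have b1 : 1 <= a ^- k by rewrite invf_ge1.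
have : 0 <= (a ^- k.+1 - a ^- k) - (a ^- k - a ^- k * a).
  have -> : a ^- k = a ^- k.+1 * a by rewrite exprS invfM mulrAC mulVf ?mul1r ?gt_eqF.
  have b0 : 0 <= a ^- k.+1 by rewrite invr_ge0 exprn_ge0// ltW.
  have -> : a ^- k.+1 - a ^- k.+1 * a - (a ^- k.+1 * a - a ^- k.+1 * a * a)
    = a ^- k.+1 * (1 - a) ^+ 2 by ring.
  by rewrite mulr_ge0// sqr_ge0.
have : 0 <= (1 - a) * (a ^- k + a ^+ k - (1 + a)).
  rewrite mulr_ge0 ?subr_ge0//.
  have amgm : 0 <= a ^- k * (1 - a ^+ k) ^+ 2.
    by rewrite mulr_ge0 ?sqr_ge0// invr_ge0 ltW.
  have : a ^- k * (1 - a ^+ k) ^+ 2 = a ^- k + a ^+ k - 2.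
    by field; rewrite gt_eqF.
  lra.
rewrite [a ^+ k.+1]exprS -natr1 expr2.
move: (a ^- k.+1) (a ^- k) (a ^+ k) IH => u w r; lra.
Qed.

Lemma powR_le_inv {R : realType} (M A r : R) : 1 < M -> 0 < A -> 0 <= r ->
  M * ln A <= r -> (1 - M^-1) `^ r <= A^-1.
Proof.
move=> M1 A0 r0 H.
have M0 : 0 < M by lra.
have iM1 : M^-1 < 1 by rewrite invf_lt1.
rewrite /powR gt_eqF ?subr_gt0//.
have -> : A^-1 = expR (- ln A) by rewrite expRN lnK.
rewrite ler_expR.
have : ln (1 - M^-1) <= - M^-1 by apply: le_ln1Dx; rewrite ltrN2.
move=> /(ler_wpM2l r0) lnM; apply: (le_trans lnM).
by rewrite mulrN lerN2 ler_pdivlMr// mulrC.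
Qed.

(** With [s = alpha^(k/2)], the inverse total weight is [s / (M (s^-1 - s))], and [geometric_gap]
    gives [s^-1 - s >= k / M]. This division absorbs the summand linear in [k]; the constant summand
    is absorbed using [k >= 1]. *)
Lemma ergodic_rate_bound {R : realType} (alpha M mu lf P0 : R) (k : nat) :
  (0 < k)%N -> 2 <= M -> alpha = 1 - M^-1 -> 0 < mu -> 0 <= lf -> 0 <= P0 ->
  (M * (alpha ^- k - 1))^-1
    * (M * (mu / 2 + lf) * P0 * (1 + k%:R * lf / (mu * M / 2)))
  <= alpha `^ (k%:R / 2) * (1 - alpha)^-1 * (mu + 2 * lf + lf ^+ 2 / mu) * P0.
Proof.
move=> k0 M2 aE mu0 lf0 P00.
have M0 : 0 < M by lra.
have iM : M^-1 <= 2^-1 by rewrite lef_pV2// posrE.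
have iM0 : 0 < M^-1 by rewrite invr_gt0.
have a0 : 0 < alpha by rewrite aE; lra.
have k1 : 1 <= k%:R :> R by rewrite ler1n.
pose s := Num.sqrt alpha ^+ k.
have rt0 : 0 < Num.sqrt alpha by rewrite sqrtr_gt0.
have rt1 : Num.sqrt alpha <= 1 by rewrite -sqrtr1 ler_sqrt// aE; lra.
have s0 : 0 < s by rewrite exprn_gt0.
have ss : alpha ^+ k = s ^+ 2 by rewrite /s exprAC sqr_sqrtr// ltW.
have -> : alpha `^ (k%:R / 2) = s.
  by rewrite mulrC powRrM powR12_sqrt ?ltW// powR_mulrn// sqrtr_ge0.
have D : k%:R * M^-1 <= s^-1 - s.
  have := @geometric_gap R (Num.sqrt alpha) k; rewrite rt0 rt1 => /(_ isT).
  by rewrite sqr_sqrtr ?(ltW a0)// {1}aE opprB addrCA subrr addr0.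
have D0 : 0 < s^-1 - s by apply: lt_le_trans D; rewrite mulr_gt0// ltr0n.
have -> : (1 - alpha)^-1 = M by rewrite aE opprB addrCA subrr addr0 invrK.
have -> : (M * (alpha ^- k - 1))^-1
    * (M * (mu / 2 + lf) * P0 * (1 + k%:R * lf / (mu * M / 2)))
  = s * P0 * ((s^-1 - s)^-1 * ((mu / 2 + lf) + k%:R * M^-1 * (lf + 2 * (lf ^+ 2 / mu)))).
  rewrite ss; field.
  have -> : 1 + - s * s = (s^-1 - s) * s by field; rewrite gt_eqF.
  by rewrite !mulf_neq0 ?gt_eqF.
rewrite [leRHS](_ : _ = s * P0 * (M * (mu + 2 * lf + lf ^+ 2 / mu))); last by ring.
rewrite ler_wpM2l ?mulr_ge0 ?(ltW s0)// ler_pdivrMl//.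
have q0 : 0 <= lf ^+ 2 / mu by rewrite divr_ge0 ?sqr_ge0// ltW.
move: q0; move: (lf ^+ 2 / mu) => q q0.
have c0 : 0 <= M * (mu + 2 * lf + q) by rewrite mulr_ge0//; lra.
apply: le_trans (ler_wpM2r c0 D).
have -> : k%:R * M^-1 * (M * (mu + 2 * lf + q)) = k%:R * (mu + 2 * lf + q).
  by field; rewrite gt_eqF.
have h1 : 0 <= (k%:R - 1) * (mu / 2 + lf) by rewrite mulr_ge0//; lra.
have h2 : 0 <= k%:R * (2^-1 - M^-1) * (lf + 2 * q).
  by rewrite mulr_ge0// ?mulr_ge0//; lra.
have h3 : 0 <= k%:R * (mu / 2 + lf / 2) by rewrite mulr_ge0//; lra.
lra.
Qed.

Section bounded_error.
Context {R : realType} {d : measure_display} {T : measurableType d}.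
Variables (Pr : probability T R) (U : Type) (X : set U).
Implicit Types (z : T -> U) (g : T -> R) (b eps lambda : R).

(** Common source of both kinds of solution: sign and measurability of [g] are what Markov's
    inequality asks for beyond the bound in mean. *)
Definition bounded_error z g b : Prop :=
  [/\ forall a, X (z a), forall a, 0 <= g a, measurable_fun setT g
    & ('E_Pr[g] <= b%:E)%E].

Lemma bounded_error_cst z b : (forall a, X (z a)) -> 0 <= b ->
  bounded_error z (cst b) b.
Proof. by move=> Xz b0; split => //; rewrite expectation_cst. Qed.

Lemma bounded_errorW z g b eps : b <= eps ->
  bounded_error z g b -> bounded_error z g eps.
Proof.
by move=> beps [Xz g0 mg Eg]; split => //; rewrite (le_trans Eg)// lee_fin.
Qed.

Lemma bounded_error_sol z g eps :
  bounded_error z g eps -> stochastic_sol Pr X z g eps.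
Proof. by case. Qed.

Lemma bounded_error_prob_sol z g eps lambda : 0 < eps ->
  bounded_error z g (lambda * eps) -> stochastic_prob_sol Pr X z g eps lambda.
Proof. by move=> eps0 [Xz g0 mg Eg]; split => //; exact: prob_le_of_expectation. Qed.

End bounded_error.

(** The weights of all words add up to the mass of [Pr], and their sum factors as a [k]-th power.
    For [k > 0] this will exclude [L = 0]. *)
Lemma iid_indices_sum {R : realType} {d : measure_display}
    {T : measurableType d} (Pr : probability T R) (m k : nat) (p : 'I_m -> R)
    (I : nat -> T -> 'I_m) :
  iid_indices Pr k p I -> (\sum_j p j) ^+ k = 1.
Proof.
move=> iidI.
have /= := expectation_word iidI (g := fun=> 1) (fun=> ler01).
rewrite (_ : _ \o _ = cst 1)// expectation_cst => -[->].
rewrite /mean; under [in RHS]eq_bigr do rewrite mulr1.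
rewrite /weight -(bigA_distr_bigA (fun _ : 'I_k => p))/=.
by rewrite prodr_const card_ord.
Qed.

(** Everything follows from [S^2 - (q - 1)^2 = 4 q C] with [C = 8 L / mu]: the product [tau * eta]
    is a difference of squares, and [L > 0] gives [S > q - 1], hence [tau > 0]. *)
Lemma rpdg_parameters {R : realType} (q mu L : R) :
  1 <= q -> 0 < mu -> 0 < L ->
  let S := Num.sqrt ((q - 1) ^+ 2 + 4 * q * (8 * L / mu)) in
  let tau := (S - (q - 1)) / (2 * q) in
  let eta := (mu * S + mu * (q - 1)) / 2 in
  [/\ 0 < tau, 0 <= eta, tau * eta = 8 * L, mu + eta = mu * (q + 1 + S) / 2
    & (1 + tau) * (2 * q) = q + 1 + S].
Proof.
move=> q1 mu0 L0 S tau eta.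
have q0 : 0 < q by lra.
have C0 : 0 < 4 * q * (8 * L / mu) by rewrite mulr_gt0 ?divr_gt0//; lra.
have S0 : 0 <= S by exact: sqrtr_ge0.
have qS : q - 1 < S.
  rewrite -[ltLHS]ger0_norm ?subr_ge0// -sqrtr_sqr ltr_sqrt ?ltrDl//.
  by rewrite ltr_wpDl ?sqr_ge0.
have SS : S ^+ 2 = (q - 1) ^+ 2 + 4 * q * (8 * L / mu).
  by rewrite sqr_sqrtr// addr_ge0 ?sqr_ge0// ltW.
have qn0 : q != 0 by rewrite gt_eqF.
have mn0 : mu != 0 by rewrite gt_eqF.
split.
- by rewrite divr_gt0 ?subr_gt0 ?mulr_gt0.
- by rewrite divr_ge0// addr_ge0// mulr_ge0 ?subr_ge0// ltW.
- have -> : tau * eta = (S ^+ 2 - (q - 1) ^+ 2) * mu / (4 * q).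
    by rewrite /tau /eta; field.
  by rewrite SS; field; rewrite qn0 mn0.
- by rewrite /eta; field.
- by rewrite /tau; field.
Qed.

(** Converts the prefactor [(1 - alpha)^-1] of the gap rate into the factor [2 (m + sqrt (m C))]
    inside the logarithm of [Ktilde]. *)
Lemma sqrt_sum_le {R : realType} (q C : R) : 1 <= q -> 0 <= C ->
  q + 1 + Num.sqrt ((q - 1) ^+ 2 + 4 * q * C) <= 2 * (q + Num.sqrt (q * C)).
Proof.
move=> q1 C0; have q0 : 0 <= q by lra.
have r0 := sqrtr_ge0 (q * C).
have rr : Num.sqrt (q * C) ^+ 2 = q * C by rewrite sqr_sqrtr// mulr_ge0.
suff : Num.sqrt ((q - 1) ^+ 2 + 4 * q * C) <= q - 1 + 2 * Num.sqrt (q * C) by lra.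
have s0 : 0 <= q - 1 + 2 * Num.sqrt (q * C) by lra.
rewrite -[leRHS]ger0_norm// -sqrtr_sqr ler_wsqrtr// [leRHS]sqrrD exprMn rr.
have : 0 <= (q - 1) * (2 * Num.sqrt (q * C)) *+ 2.
  by rewrite mulrn_wge0// !mulr_ge0// subr_ge0.
rewrite -natrX; lra.
Qed.

Lemma distance_iterations {R : realType} (M c P eps : R) (k : nat) :
  2 <= M -> 0 < c -> 0 <= P -> 0 < eps ->
  M * ln (c * (P / eps)) <= k%:R -> c * (1 - M^-1) ^+ k * P <= eps.
Proof.
(* For [P = 0] the logarithm has argument 0 and only a default value; the error bound is then 0. *)
move=> M2 c0; rewrite le_eqVlt => /predU1P[<-|P0] eps0 H.
  by rewrite mulr0 ltW.
have M1 : 1 < M by lra.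
have A0 : 0 < c * (P / eps) by rewrite mulr_gt0// divr_gt0.
have iM : M^-1 < 1 by rewrite invf_lt1//; lra.
have := powR_le_inv M1 A0 (ler0n _ k) H; rewrite powR_mulrn; last by lra.
have cP0 : 0 <= c * P by rewrite mulr_ge0// ltW.
move=> /(ler_wpM2l cP0); rewrite mulrAC => /le_trans; apply.
rewrite le_eqVlt; apply/orP; left; apply/eqP.
by field; rewrite !gt_eqF.
Qed.

Lemma gap_iterations {R : realType} (M D c P eps : R) (k : nat) :
  2 <= M -> 0 < D -> 0 < c -> 0 <= P -> 0 < eps -> (0 < P -> M <= 2 * D) ->
  2 * M * ln (2 * c * D * (P / eps)) <= k%:R ->
  (1 - M^-1) `^ (k%:R / 2) * M * c * P <= eps.
Proof.
move=> M2 D0 c0; rewrite le_eqVlt => /predU1P[<-|P0] eps0 MD H.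
  by rewrite mulr0 ltW.
have M1 : 1 < M by lra.
have A0 : 0 < 2 * c * D * (P / eps) by rewrite !mulr_gt0// invr_gt0.
have H2 : M * ln (2 * c * D * (P / eps)) <= k%:R / 2 by lra.
have k2 : 0 <= k%:R / 2 :> R by rewrite divr_ge0.
have := powR_le_inv M1 A0 k2 H2.
have cP0 : 0 <= M * c * P by rewrite !mulr_ge0// ltW//; lra.
move=> /(ler_wpM2l cP0); rewrite mulrC !mulrA => /le_trans; apply.
rewrite [leLHS](_ : _ = M * eps / (2 * D)); last by field; rewrite !gt_eqF.
by rewrite ler_pdivrMr ?mulr_gt0// mulrC ler_wpM2l ?(ltW eps0)// MD.
Qed.

(** * Convergence *)

Section convergence.
Context {R : realType} {n m : nat} {d : measure_display} {T : measurableType d}.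
Local Notation V := 'rV[R]_n.
Variables (X : set V) (N : V -> R) (f : 'I_m -> V -> R) (h omega : V -> R).
Variables (l p : 'I_m -> R) (mu eta tau alpha L M L_f : R) (xs x0 v0 : V).
Variables (k : nat) (I : nat -> T -> 'I_m).
Variables (x v : nat -> T -> V) (xu y yt : nat -> T -> 'I_m -> V).
Let Psi z := \sum_(i < m) f i z + h z + mu * omega z.
Hypothesis cX : convex_set X.
Hypothesis normN : is_norm N.
Hypothesis cf : forall i, convex_function [set: V] (f i).
Hypothesis df : forall i z, differentiable (f i : V -> R^o) z.
Hypothesis lipf : forall i, lipschitz_grad N (f i) (l i).
Hypothesis Lf0 : 0 <= L_f.
Hypothesis lipF : lipschitz_grad N (fun z => \sum_(i < m) f i z) L_f.
Hypothesis ch : convex_function X h.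
Hypothesis scw : strongly_convex X N 1 omega.
Hypothesis xs_opt : is_argmin X Psi xs.
Hypothesis p0 : forall i, 0 < p i.
Hypothesis p_sum : \sum_i p i = 1.
Hypothesis l_le : forall i, l i <= 2 * L * p i.
Hypothesis L0 : 0 <= L.
Hypothesis mu0 : 0 < mu.
Hypothesis eta0 : 0 <= eta.
Hypothesis tau0 : 0 < tau.
Hypothesis alpha0 : 0 < alpha.
Hypothesis alpha1 : alpha <= 1.
Hypothesis tau_eta : 8 * L <= tau * eta.
Hypothesis alpha_prox : eta <= alpha * (mu + eta).
Hypothesis alpha_dual : forall i, (1 + tau) * (1 - alpha) <= p i.
Hypothesis p_inv : forall i, (1 + tau) * (p i)^-1 <= M.
Hypothesis Xx0 : X x0.
Hypothesis sv0 : subdiff X omega x0 v0.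
Hypothesis path : forall a, rpdg_path X f h omega mu p
  (fun=> tau) (fun=> eta) (fun=> alpha) x0 v0 k
  (I^~ a) (x^~ a) (v^~ a) (xu^~ a) (y^~ a) (yt^~ a).
Hypothesis nonant : nonanticipating k I v.
Local Notation word := {ffun 'I_k -> 'I_m}.
Variable rho : word -> T.
Hypothesis rhoK : forall s, word_of k I (rho s) = s.

Let Xxs : X xs. Proof. by case: xs_opt. Qed.
Let me0 : 0 < mu + eta. Proof. by rewrite ltr_wpDr. Qed.

Let gap t a := lagrangian_gap f h omega mu xs (x t a).
Let dist t a := prox_fun omega (v t a) (x t a) xs.
Let lyap t a := lyapunov f omega p mu eta tau xs
  (x t.-1 a) (v t.-1 a) (x t a) (v t a) (xu t.-1 a) (xu t a).

Lemma iterates_in t a : (t <= k)%N -> X (x t a) /\ subdiff X omega (x t a) (v t a).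
Proof. by move=> tk; exact: (rpdg_in (path a)). Qed.

Lemma iterates_determined t a b : (t <= k)%N ->
  (forall s, (0 < s <= t)%N -> I s a = I s b) ->
  [/\ x t a = x t b, v t a = v t b & xu t a = xu t b].
Proof.
move=> tk ab.
have vab s : (s <= t)%N -> v s a = v s b.
  move=> st; apply: nonant; first exact: leq_trans st tk.
  by move=> r /andP[r0 rs]; rewrite ab// r0 (leq_trans rs st).
have [-> _ ->] := rpdg_determined cX normN scw me0 (path a) (path b) tk ab vab.
by rewrite vab.
Qed.

Lemma word_of_agree t a b : (t <= k)%N ->
  (forall u : 'I_k, (u < t)%N -> word_of k I a u = word_of k I b u) ->
  forall s, (0 < s <= t)%N -> I s a = I s b.
Proof.
move=> tk ab [//|s] /= st.
by have := ab (Ordinal (leq_trans st tk)) st; rewrite !ffunE.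
Qed.

Lemma xu_same t a i : (t <= k)%N -> i != I t a -> xu t.-1 a i = xu t a i.
Proof.
(* At [t = 0] the predecessor is 0 itself, so the equality is trivial although [I 0] is not a
   draw. *)
case: t => // t tk ir.
by rewrite (rpdg_xuE (path a) i tk) (negbTE ir).
Qed.

(** Letter [t] is redrawn while the others are kept. The sample points [b j] share the draws up to
    [t] with [rho s], hence the iterates up to [t], and differ in the draw [t.+1 = j]; [rpdg_step]
    averages over exactly this family. *)
Lemma mean_lyap_step t : (t < k)%N ->
  mean p (fun s => gap t.+1 (rho s) + lyap t.+1 (rho s))
  <= alpha * mean p (fun s => lyap t (rho s)).
Proof.
move=> tk; rewrite (mean_redraw p_sum (Ordinal tk)) -meanZ.
apply: le_mean => [j|s]; first exact: ltW.
pose b j := rho (redraw s (Ordinal tk) j).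
have bs j r : (0 < r <= t)%N -> I r (b j) = I r (rho s).
  move: r; apply: word_of_agree => [|u ut]; first exact: ltnW.
  by rewrite !rhoK redraw_neq// -val_eqE /= ltn_eqF.
have bj j : I t.+1 (b j) = j.
  have := congr1 (fun q : word => q (Ordinal tk)) (rhoK (redraw s (Ordinal tk) j)).
  by rewrite redraw_eq ffunE.
have tk' := ltnW tk.
have [Xx sv] := iterates_in (rho s) tk'.
have [Xx' sv'] := iterates_in (rho s) (leq_trans (leq_pred t) tk').
have same i := @xu_same t (rho s) i tk'.
pose xt := alpha *: (x t (rho s) - x t.-1 (rho s)) + x t (rho s).
have xuE j i : xu t.+1 (b j) i = if i == j
    then (1 + tau)^-1 *: (xt + tau *: xu t (rho s) i) else xu t (rho s) i.
  have [e1 _ e3] := iterates_determined tk' (bs j).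
  have [||e4 _ _] := @iterates_determined t.-1 (b j) (rho s).
  - exact: leq_trans (leq_pred t) tk'.
  - by move=> r /andP[r0 rt]; rewrite bs// r0 (leq_trans rt (leq_pred t)).
  by rewrite (rpdg_xuE (path (b j)) i tk) bj e1 e3 e4.
have step j : prox_step X h omega mu
    (\sum_i ytilde f p (xu t (rho s)) (xu t.+1 (b j)) i)
    (x t (rho s)) (v t (rho s)) eta (x t.+1 (b j)) (v t.+1 (b j)).
  have [e1 e2 e3] := iterates_determined tk' (bs j).
  by have := rpdg_stepE (path (b j)) tk; rewrite e1 e2 e3.
have alpha01 : 0 <= alpha <= 1 by rewrite ltW.
have := @rpdg_step _ _ _ X N f h omega l p mu eta tau alpha L xs cX normN cf df
  lipf scw Xxs p0 p_sum l_le eta0 tau0 alpha01 tau_eta alpha_prox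
  alpha_dual _ _ _ _ _ _ _ _ _ _ Xx' Xx sv' sv same xuE step.
apply: le_trans; rewrite le_eqVlt; apply/orP; left; apply/eqP.
apply: eq_bigr => j _; congr (_ * (_ + _)).
have [e1 e2 e3] := iterates_determined tk' (bs j).
by rewrite /lyap /= e1 e2 e3.
Qed.

Lemma gap_ge0 t a : (t <= k)%N -> 0 <= gap t a.
Proof.
move=> tk; have [Xx _] := iterates_in a tk.
have := @argmin_first_order _ _ X N cX normN (fun z => \sum_(i < m) f i z)
  (fun z => h z + mu * omega z) L_f xs (x t a) _ lipF _ _ Xx.
rewrite grad_sum; last by move=> i; exact: df.
apply.
- by move=> z; apply: differentiable_fun_sum => i; exact: df.
- move=> y1 y2 r Xy1 Xy2 r01.
  have hc := convex_lineE ch Xy1 Xy2 r01.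
  have := ler_wpM2l (ltW mu0) (scw Xy1 Xy2 r01).
  have /andP[r0 r1] := r01.
  have : 0 <= mu * (1 / 2 * (r * (1 - r)) * N (y1 - y2) ^+ 2).
    rewrite mulr_ge0 ?(ltW mu0)// mulr_ge0 ?sqr_ge0// mulr_ge0//.
    by rewrite mulr_ge0// subr_ge0.
  move: hc; move: (h _) (omega _) (N _ ^+ 2) => a1 a2 a3 hc; lra.
- case: xs_opt => _ opt; split => // z Xz.
  by rewrite !addrA; exact: opt.
Qed.

Let P0 := prox_fun omega v0 x0 xs.

(** Smoothness of the sum, not of each [f i], is used here; this puts [L_f] in place of [L] in the
    constants of the rates. *)
Lemma bregman_sum_le z :
  \sum_(i < m) bregman (f i) z xs <= L_f / 2 * N (z - xs) ^+ 2.
Proof.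
rewrite -bregman_sum; last exact: df.
apply: (bregman_le normN _ lipF) => y1.
by apply: differentiable_fun_sum => i; exact: df.
Qed.

Lemma bregman_le_prox z vz : X z -> subdiff X omega z vz ->
  \sum_(i < m) bregman (f i) z xs <= L_f * prox_fun omega vz z xs.
Proof.
move=> Xz svz; apply: (le_trans (bregman_sum_le z)).
rewrite -opprB (is_normN normN) -mulrA ler_wpM2l//.
by rewrite mulrC; exact: (prox_fun_ge cX scw Xz Xxs svz).
Qed.

Lemma lyap0_le a : lyap 0 a <= (mu + eta + M * L_f) * P0.
Proof.
rewrite /lyap /= /lyapunov (rpdg_x0 (path a)) (rpdg_v0 (path a)).
rewrite !prox_funxx subrr dotp0r mulr0 subr0 addr0.
rewrite [X in tau / 2 * X]big1 => [|i _]; last by rewrite bregmanxx mulr0.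
rewrite mulr0 addr0 [leRHS]mulrDl lerD2l -mulrA.
(* [p_inv] bounds [M] from below only if some index exists; [I 0 a] serves as one. *)
have M0 (i : 'I_m) : 0 <= M.
  by rewrite (le_trans _ (p_inv i))// mulr_ge0 ?invr_ge0// ltW// addr_gt0.
apply: (@le_trans _ _ (M * \sum_(i < m) bregman (f i) x0 xs)).
  rewrite !mulr_sumr; apply: ler_sum => i _; rewrite (rpdg_xu0 (path a)) mulrA.
  by rewrite ler_wpM2r// (bregman_ge0 normN (df i) (lipf i)).
rewrite ler_wpM2l ?(M0 (I 0 a))//; exact: bregman_le_prox.
Qed.

Lemma sum_mean_gap t : (t <= k)%N ->
  \sum_(1 <= r < t.+1) alpha ^- r * mean p (fun s => gap r (rho s))
  + alpha ^- t * mean p (fun s => lyap t (rho s))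
  <= (mu + eta + M * L_f) * P0.
Proof.
elim: t => [|t IH] tk.
  rewrite big_geq// add0r expr0 invr1 mul1r.
  rewrite -[leRHS](mean_cst (k := k) p_sum); apply: le_mean => [j|s]; first exact: ltW.
  exact: lyap0_le.
apply: le_trans (IH (ltnW tk)); rewrite big_nat_recr//= -addrA lerD2l.
rewrite -mulrDr -meanD exprS invfM -mulrA ler_pdivrMl// [leRHS]mulrCA.
apply: ler_wpM2l; first by rewrite invr_ge0 exprn_ge0// ltW.
exact: mean_lyap_step.
Qed.

Lemma lyap_ge_dist t a : (t <= k)%N -> (mu + eta) * dist t a <= lyap t a.
Proof.
move=> tk; have [Xx sv] := iterates_in a tk.
have [Xx' sv'] := iterates_in a (leq_trans (leq_pred t) tk).
apply: (@lyapunov_ge _ _ _ X N f omega l p mu eta tau L xs cX normN cf df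
  lipf scw p0 p_sum l_le L0 eta0 tau0 tau_eta _ _ _ _ _ _ (I t a)) => //.
by move=> i; exact: xu_same.
Qed.

Lemma mean_dist_le t : (t <= k)%N ->
  (mu + eta) * mean p (fun s => dist t (rho s))
  <= alpha ^+ t * ((mu + eta + M * L_f) * P0).
Proof.
move=> tk; rewrite -meanZ.
apply: (@le_trans _ _ (mean p (fun s => lyap t (rho s)))).
  by apply: le_mean => [j|s]; [exact: ltW|exact: lyap_ge_dist].
rewrite -ler_pdivrMl ?exprn_gt0//; apply: le_trans (sum_mean_gap tk).
rewrite lerDr big_nat; apply: sumr_ge0 => r /andP[_ rt].
rewrite mulr_ge0 ?invr_ge0 ?exprn_ge0 ?(ltW alpha0)// -[leLHS](mean_cst (k := k) p_sum).
apply: le_mean => [j|s]; first exact: ltW.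
by apply: gap_ge0; exact: leq_trans (rt : (r <= t)%N) tk.
Qed.

Lemma sum_mean_gap_le :
  \sum_(1 <= r < k.+1) alpha ^- r * mean p (fun s => gap r (rho s))
  <= (mu + eta + M * L_f) * P0.
Proof.
apply: le_trans (sum_mean_gap (leqnn k)); rewrite lerDl.
rewrite mulr_ge0 ?invr_ge0 ?exprn_ge0 ?(ltW alpha0)//.
rewrite -[leLHS](mean_cst (k := k) p_sum).
apply: le_mean => [j|s]; first exact: ltW.
have [Xx sv] := iterates_in (rho s) (leqnn k).
apply: le_trans (lyap_ge_dist (rho s) (leqnn k)).
by rewrite mulr_ge0 ?(ltW me0)// (prox_fun_ge0 cX scw).
Qed.

(** The objective gap is exactly [Q] plus the Bregman distances of the [f i] to [xs], and
    [bregman_le_prox] bounds their sum. *)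
Lemma objective_le t a : (t <= k)%N ->
  Psi (x t a) - Psi xs <= gap t a + L_f * dist t a.
Proof.
move=> tk; have [Xx sv] := iterates_in a tk.
have := bregman_le_prox Xx sv.
rewrite /Psi /gap /lagrangian_gap /dist /bregman !sumrB dotp_suml.
move: (prox_fun _ _ _ _) => q; lra.
Qed.

Variable Pr : probability T R.
Hypothesis iidI : iid_indices Pr k p I.
Hypothesis k0 : (0 < k)%N.
Hypothesis M2 : 2 <= M.
Hypothesis alphaE : alpha = 1 - M^-1.
Hypothesis mu_eta : mu + eta = mu * M / 2.

Let P0_ge0 : 0 <= P0.
Proof. exact: (prox_fun_ge0 cX scw). Qed.

Let initE : (mu + eta + M * L_f) * P0 = M * (mu / 2 + L_f) * P0.
Proof. by rewrite mu_eta; ring. Qed.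

Lemma dist_ge0 t a : (t <= k)%N -> 0 <= dist t a.
Proof.
by move=> tk; have [Xx sv] := iterates_in a tk; exact: (prox_fun_ge0 cX scw).
Qed.

Lemma dist_rate :
  measurable_fun setT (dist k)
  /\ ('E_Pr[dist k] <= ((1 + 3 * L_f / mu) * alpha ^+ k * P0)%:E)%E.
Proof.
have dist_det a b : (forall s, (0 < s <= k)%N -> I s a = I s b) ->
    dist k a = dist k b.
  move=> /(iterates_determined (leqnn k))[e1 e2 _].
  by rewrite /dist e1 e2.
have [md ->] := factor_expectation iidI rhoK dist_det (fun a => dist_ge0 a (leqnn k)).
split => //; rewrite lee_fin -(ler_pM2l me0).
apply: (le_trans (mean_dist_le (leqnn k))).
have M0 : 0 < M by rewrite (lt_le_trans _ M2).
(* Here [mu + eta = mu M / 2] is used; the constant obtained is [1 + 2 L_f / mu], relaxed below to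
   the stated one. *)
have -> : mu + eta + M * L_f = (mu + eta) * (1 + 2 * L_f / mu).
  by rewrite mu_eta; field; rewrite gt_eqF.
rewrite mulrCA -!mulrA ler_wpM2l ?(ltW me0)// mulrCA.
rewrite [leRHS]mulrCA !mulrA.
rewrite ler_wpM2r// ler_wpM2l ?exprn_ge0 ?(ltW alpha0)// lerD2l.
rewrite ler_wpM2r ?invr_ge0 ?(ltW mu0)// ler_wpM2r//.
by rewrite ler_nat.
Qed.

Let theta t : R := alpha ^- t.
Let xbar a := (\sum_(1 <= t < k.+1) theta t)^-1
              *: \sum_(1 <= t < k.+1) theta t *: x t a.

Lemma objective_convex (y1 y2 : V) (r : R) : X y1 -> X y2 -> 0 <= r <= 1 ->
  Psi (r *: y1 + (1 - r) *: y2) <= r * Psi y1 + (1 - r) * Psi y2.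
Proof.
move=> Xy1 Xy2 r01; have /andP[r0 r1] := r01.
have hc := convex_lineE ch Xy1 Xy2 r01.
have oc := ler_wpM2l (ltW mu0) (scw Xy1 Xy2 r01).
have pos : 0 <= mu * (1 / 2 * (r * (1 - r)) * N (y1 - y2) ^+ 2).
  rewrite mulr_ge0 ?(ltW mu0)// mulr_ge0 ?sqr_ge0// mulr_ge0//.
  by rewrite mulr_ge0// subr_ge0.
have fc : \sum_(i < m) f i (r *: y1 + (1 - r) *: y2)
          <= r * (\sum_(i < m) f i y1) + (1 - r) * (\sum_(i < m) f i y2).
  rewrite !mulr_sumr -big_split/=; apply: ler_sum => i _.
  exact: (convex_lineE (cf i) Logic.I Logic.I r01).
move: hc oc pos fc; rewrite /Psi.
move: (\sum_(i < m) _) (\sum_(i < m) _) (\sum_(i < m) _) => s1 s2 s3.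
move: (h _) (h _) (h _) (omega _) (omega _) (omega _) (N _ ^+ 2).
move=> h1 h2 h3 o1 o2 o3 q; lra.
Qed.

Lemma ergodic_gap_le a : X (xbar a) /\
  (Psi (xbar a) - Psi xs <= (\sum_(1 <= t < k.+1) theta t)^-1
    * \sum_(1 <= t < k.+1) theta t * (gap t a + L_f * dist t a)).
Proof.
have [|t|t tk||XW FW] := @weighted_average_convex _ _ X
  (fun z => Psi z - Psi xs) theta (x^~ a) k.
- move=> y1 y2 r Xy1 Xy2 r01; split; first exact: convex_set_line.
  have := objective_convex Xy1 Xy2 r01; lra.
- by rewrite invr_gt0 exprn_gt0.
- by have [] := iterates_in a tk.
- exact: k0.
split; first exact: XW.
apply: (le_trans FW); rewrite ler_wpM2l//.
  by rewrite invr_ge0; apply: sumr_ge0 => t _; rewrite invr_ge0 exprn_ge0// ltW.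
rewrite !big_nat; apply: ler_sum => t /andP[_ tk].
rewrite ler_wpM2l ?invr_ge0 ?exprn_ge0 ?(ltW alpha0)//.
exact: objective_le.
Qed.

Let ergodic_gap a : R := Psi (xbar a) - Psi xs.

Lemma ergodic_rate :
  measurable_fun setT ergodic_gap
  /\ ('E_Pr[ergodic_gap]
      <= (alpha `^ (k%:R / 2) * (1 - alpha)^-1
          * (mu + 2 * L_f + L_f ^+ 2 / mu) * P0)%:E)%E.
Proof.
have det a b : (forall s, (0 < s <= k)%N -> I s a = I s b) ->
    ergodic_gap a = ergodic_gap b.
  move=> ab; congr (Psi (_ *: _) - _).
  apply: eq_big_nat => t /andP[t0 tk]; congr (_ *: _).
  have [] // := @iterates_determined t a b tk.
  by move=> s /andP[s0 st]; rewrite ab// s0 (leq_trans st tk).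
have pos a : 0 <= ergodic_gap a.
  by rewrite subr_ge0; case: xs_opt => _; apply; case: (ergodic_gap_le a).
have [md ->] := factor_expectation iidI rhoK det pos.
split => //; rewrite lee_fin.
apply: le_trans (ergodic_rate_bound k0 M2 alphaE mu0 Lf0 P0_ge0).
have M0 : M != 0 by rewrite gt_eqF// (lt_le_trans _ M2).
rewrite -(sum_geometric k (lt0r_neq0 alpha0) M0 alphaE).
have p_ge0 j := ltW (p0 j).
apply: le_trans (le_mean p_ge0 (fun s => (ergodic_gap_le (rho s)).2)) _.
rewrite meanZ mean_sum ler_wpM2l//.
  by rewrite invr_ge0; apply: sumr_ge0 => t _; rewrite invr_ge0 exprn_ge0// ltW.
under eq_bigr do rewrite meanZ meanD meanZ mulrDr.
rewrite big_split/= mulrDr mulr1 -initE -mu_eta lerD//; first exact: sum_mean_gap_le.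
(* In the distance part the weight [alpha^-t] cancels the decay [alpha^t], so all [k] terms have the
   same bound; this is the factor [k] absorbed by [ergodic_rate_bound]. *)
rewrite big_nat; apply: (@le_trans _ _ (\sum_(1 <= t < k.+1)
    (mu + eta + M * L_f) * P0 * (L_f / (mu + eta)))); last first.
  by rewrite sumr_const_nat subn1 -[leLHS]mulr_natl [leLHS]mulrCA [k%:R * (_ / _)]mulrA.
rewrite big_nat; apply: ler_sum => t /andP[_ tk].
rewrite ler_pdivrMl ?exprn_gt0//.
rewrite [leRHS](_ : _ = L_f * ((mu + eta)^-1
  * (alpha ^+ t * ((mu + eta + M * L_f) * P0)))); last by ring.
by rewrite ler_wpM2l// ler_pdivlMl//; exact: mean_dist_le.
Qed.

Lemma rpdg_rates :
  bounded_error Pr X (x k) (dist k) ((1 + 3 * L_f / mu) * alpha ^+ k * P0)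
  /\ bounded_error Pr X xbar ergodic_gap
       (alpha `^ (k%:R / 2) * (1 - alpha)^-1
        * (mu + 2 * L_f + L_f ^+ 2 / mu) * P0).
Proof.
have [md Ed] := dist_rate; have [mg Eg] := ergodic_rate.
split; split => // a.
- by have [] := iterates_in a (leqnn k).
- exact: dist_ge0.
- by have [] := ergodic_gap_le a.
- by rewrite subr_ge0; case: xs_opt => _; apply; case: (ergodic_gap_le a).
Qed.

End convergence.

Theorem corollary1 (R : realType) (n m : nat)
    (X : set 'rV[R]_n) (N : 'rV[R]_n -> R)
    (f : 'I_m -> 'rV[R]_n -> R) (h omega : 'rV[R]_n -> R)
    (L_ : 'I_m -> R) (L_f mu : R) (xstar x0 v0 : 'rV[R]_n)
    (d : measure_display) (T : measurableType d) (Pr : probability T R)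
    (k : nat) (I : nat -> T -> 'I_m)
    (x v : nat -> T -> 'rV[R]_n) (xu y yt : nat -> T -> 'I_m -> 'rV[R]_n) :
  let fsum := fun z => \sum_(i < m) f i z in
  let L := \sum_(i < m) L_ i in
  let Psi := fun z => fsum z + h z + mu * omega z in
  let C := 8 * L / mu in
  let S := Num.sqrt ((m%:R - 1) ^+ 2 + 4 * m%:R * C) in
  let p := fun i => 1 / (2 * m%:R) + L_ i / (2 * L) in
  let tau := (S - (m%:R - 1)) / (2 * m%:R) in
  let eta := (mu * S + mu * (m%:R - 1)) / 2 in
  let alpha := 1 - 1 / ((m%:R + 1) + S) in
  let theta := fun t : nat => alpha ^- t in
  let xbar := fun a => (\sum_(1 <= t < k.+1) theta t)^-1
                       *: \sum_(1 <= t < k.+1) theta t *: x t a in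
  let P0 := prox_fun omega v0 x0 xstar in
  let dist := fun a => prox_fun omega (v k a) (x k a) xstar in
  let gap := fun a => Psi (xbar a) - Psi xstar in
  let K := fun eps =>
    ((m%:R + 1) + S) * ln ((1 + 3 * L_f / mu) * (P0 / eps)) in
  let Ktilde := fun eps =>
    2 * ((m%:R + 1) + S)
    * ln (2 * (mu + 2 * L_f + L_f ^+ 2 / mu)
          * (m%:R + Num.sqrt (m%:R * C)) * (P0 / eps)) in
  closed X -> convex_set X -> is_norm N ->
  (forall i, convex_function setT (f i)) ->
  (forall i z, differentiable (f i : 'rV[R]_n -> R^o) z) ->
  (forall i, lipschitz_grad N (f i) (L_ i)) ->
  0 <= L_f -> lipschitz_grad N fsum L_f ->
  (forall x1 x2, L_f * N (x1 - x2) <= L * N (x1 - x2)) ->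
  convex_function X h -> strongly_convex X N 1 omega ->
  0 < mu -> is_argmin X Psi xstar ->
  X x0 -> subdiff X omega x0 v0 ->
  iid_indices Pr k p I ->
  (forall a, rpdg_path X f h omega mu p
               (fun=> tau) (fun=> eta) (fun=> alpha) x0 v0 k
               (I^~ a) (x^~ a) (v^~ a) (xu^~ a) (y^~ a) (yt^~ a)) ->
  nonanticipating k I v ->
  [/\ (1 <= k)%N ->
        ('E_Pr[dist] <= ((1 + 3 * L_f / mu) * alpha ^+ k * P0)%:E)%E,
      (1 <= k)%N ->
        ('E_Pr[gap] <= (alpha `^ (k%:R / 2) * (1 - alpha)^-1
                        * (mu + 2 * L_f + L_f ^+ 2 / mu) * P0)%:E)%E,
      forall eps, 0 < eps ->
        (K eps <= k%:R -> stochastic_sol Pr X (x k) dist eps) /\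
        (forall lambda, 0 < lambda < 1 -> K (lambda * eps) <= k%:R ->
           stochastic_prob_sol Pr X (x k) dist eps lambda) &
      (1 <= k)%N -> forall eps, 0 < eps ->
        (Ktilde eps <= k%:R -> stochastic_sol Pr X xbar gap eps) /\
        (forall lambda, 0 < lambda < 1 -> Ktilde (lambda * eps) <= k%:R ->
           stochastic_prob_sol Pr X xbar gap eps lambda)].

Proof.
move=> fsum L Psi C S p tau eta alpha theta xbar P0 dist gap K Ktilde.
move=> _ cX normN cf df lipf Lf0 lipF _ ch scw mu0 opt Xx0 sv0 iidI path nonant.
(* [I 0] maps a space of probability 1, hence nonempty, into ['I_m]. *)
have m0 : (0 < m)%N.
  rewrite lt0n; apply/eqP => mE.
  have T0 : [set: T] = set0.
    apply/seteqP; split => // a _.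
    by have := ltn_ord (I 0%N a); rewrite [X in (_ < X)%N]mE.
  by have := probability_setT Pr; rewrite T0 measure0 => /eqP; rewrite eq_sym onee_eq0.
have Xxs : X xstar by case: opt.
have P00 : 0 <= P0 by exact: (prox_fun_ge0 cX scw).
have q1 : 1 <= m%:R :> R by rewrite ler1n.
have S0 : 0 <= S by exact: sqrtr_ge0.
pose M := m%:R + 1 + S.
have M2 : 2 <= M by rewrite /M; lra.
have alphaE : alpha = 1 - M^-1 by rewrite /alpha div1r.
have c1 : 0 < 1 + 3 * L_f / mu by rewrite ltr_wpDr// divr_ge0 ?(ltW mu0)// mulr_ge0.
have c2 : 0 < mu + 2 * L_f + L_f ^+ 2 / mu.
  by rewrite ltr_wpDr ?divr_ge0 ?sqr_ge0 ?(ltW mu0)// ltr_wpDr// mulr_ge0.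
have D0 : 0 < m%:R + Num.sqrt (m%:R * C) by rewrite ltr_wpDr ?sqrtr_ge0// ltr0n.
have vec0 : n = 0%N -> forall z z' : 'rV[R]_n, z = z'.
  by move=> nE z z'; apply/rowP => -[j jn]; exfalso; rewrite nE in jn.
have L_ge0 : (0 < n)%N -> forall i, 0 <= L_ i.
  by move=> n0 i; exact: (lipschitz_grad_ge0 normN n0 (lipf i)).
have rates : bounded_error Pr X (x k) dist ((1 + 3 * L_f / mu) * alpha ^+ k * P0)
  /\ ((0 < k)%N -> bounded_error Pr X xbar gap
        (alpha `^ (k%:R / 2) * (1 - alpha)^-1
         * (mu + 2 * L_f + L_f ^+ 2 / mu) * P0)).
  (* For [n = 0] the signs of the [L_ i] are unknown, but the space is a single point and both
     errors vanish. *)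
  have [n0|n0] := posnP n.
    have all_eq := vec0 n0.
    have P0E : P0 = 0 by rewrite /P0 (all_eq xstar x0) prox_funxx.
    have -> : dist = cst 0.
      by apply/funext => a; rewrite /dist (all_eq xstar (x k a)) prox_funxx.
    have -> : gap = cst 0.
      by apply/funext => a; rewrite /gap (all_eq xstar (xbar a)) subrr.
    rewrite P0E !mulr0; split=> [|_]; apply: bounded_error_cst => // a.
      by rewrite (all_eq (x k a) x0).
    by rewrite (all_eq (xbar a) x0).
  (* Without draws [iid_indices] says nothing about [p]; the distance is then [P0] itself, which
     suffices for the claim on distances at [k = 0]. *)
  have [k0|k0] := posnP k.
    have [xE vE] : (forall a, x k a = x0) /\ (forall a, v k a = v0).
      by rewrite k0; split=> a; [exact: (rpdg_x0 (path a))|exact: (rpdg_v0 (path a))].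
    split=> //; rewrite (_ : dist = cst P0); last first.
      by apply/funext => a; rewrite /dist xE vE.
    apply: (@bounded_errorW _ _ _ _ _ _ _ _ P0); last first.
      by apply: bounded_error_cst => // a; rewrite xE.
    rewrite {1}k0 expr0 mulr1 ler_peMl// lerDl divr_ge0 ?(ltW mu0)// mulr_ge0//.
  (* If [L = 0], division by zero returns 0 and the [p i] add up to [1 / 2], which contradicts
     [iid_indices_sum]. *)
  have L0 : 0 < L.
    rewrite lt_neqAle sumr_ge0 => [|i _]; last exact: L_ge0.
    rewrite andbT; apply/eqP => LE.
    have := iid_indices_sum iidI.
    have -> : \sum_j p j = 2^-1.
      rewrite (eq_bigr (fun=> 1 / (2 * m%:R))) => [|i _]; last first.
        by rewrite /p -LE mulr0 invr0 mulr0 addr0.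
      rewrite sumr_const card_ord -mulr_natl; field.
      by rewrite gt_eqF ?ltr0n.
    move=> /eqP; apply/negP; rewrite lt_eqF//.
    by rewrite exprn_ilt1 ?invr_ge0// ?invf_lt1 ?ltr1n// -lt0n.
  have p_sum : \sum_i p i = 1.
    rewrite big_split/= sumr_const card_ord -mulr_suml -/L.
    rewrite -mulr_natl; field.
    by rewrite gt_eqF//= gt_eqF ?ltr0n.
  (* The uniform half of [p] gives this lower bound, used for [alpha_dual] and [p_inv]; the half
     proportional to [L_ i] gives [Lp]. *)
  have p_ge i : 1 / (2 * m%:R) <= p i by rewrite lerDl divr_ge0 ?L_ge0// mulr_ge0// ltW.
  have p0 i : 0 < p i by apply: lt_le_trans (p_ge i); rewrite divr_gt0 ?mulr_gt0 ?ltr0n.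
  have [tau0 eta0 tau_eta mu_eta M_tau] := rpdg_parameters q1 mu0 L0.
  have /choice[rho rhoK] := word_of_surj iidI p0.
  have M1 : 1 < M by rewrite (lt_le_trans _ M2)// ltr1n.
  have M0 : 0 < M by rewrite (lt_trans ltr01).
  have Mn0 : M != 0 by rewrite gt_eqF.
  have q0 : 0 < 2 * m%:R :> R by rewrite mulr_gt0// ltr0n.
  have iM0 : 0 < M^-1 by rewrite invr_gt0.
  have iM1 : M^-1 < 1 by rewrite invf_lt1.
  have alpha0 : 0 < alpha by rewrite alphaE subr_gt0.
  have alpha1 : alpha <= 1 by rewrite alphaE lerBlDr lerDl ltW.
  have Lp i : L_ i <= 2 * L * p i.
    have -> : 2 * L * p i = L / m%:R + L_ i.
      by rewrite /p; field; rewrite !gt_eqF ?ltr0n.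
    by rewrite lerDr divr_ge0// ltW.
  have tau_eta' : 8 * L <= tau * eta by rewrite /tau /eta tau_eta.
  have alpha_prox : eta <= alpha * (mu + eta).
    have me : mu + eta = mu * M / 2 by exact: mu_eta.
    have -> : eta = mu * M / 2 - mu by rewrite -me addrC addKr.
    have -> : alpha * (mu + (mu * M / 2 - mu)) = mu * M / 2 - mu / 2.
      by rewrite alphaE; field.
    rewrite lerD2l lerN2 ler_pdivrMr// ler_peMr ?(ltW mu0)// ler1n//.
  have tauE : 1 + tau = M / (2 * m%:R).
    by rewrite -[M]M_tau mulfK// gt_eqF.
  have alpha_dual i : (1 + tau) * (1 - alpha) <= p i.
    apply: le_trans (p_ge i); rewrite tauE alphaE opprB addrCA subrr addr0.
    by rewrite mulrAC mulfV.
  have p_inv i : (1 + tau) * (p i)^-1 <= M.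
    rewrite -[leRHS]M_tau ler_wpM2l ?addr_ge0 ?(ltW tau0)//.
    by rewrite -[leRHS]invrK lef_pV2 ?posrE ?invr_gt0// -div1r.
  have [r1 r2] := rpdg_rates cX normN cf df lipf Lf0 lipF ch scw opt p0 p_sum Lp
    (ltW L0) mu0 eta0 tau0 alpha0 alpha1 tau_eta' alpha_prox alpha_dual p_inv
    Xx0 sv0 path nonant rhoK iidI k0 M2 alphaE mu_eta.
  by split=> [|_]; [exact: r1|exact: r2].
have [rate1 rate2] := rates.
split.
- by move=> _; case: rate1.
- by move=> k0; case: (rate2 k0).
- move=> eps eps0; split.
    move=> H; apply: bounded_error_sol; apply: bounded_errorW rate1.
    by rewrite alphaE; exact: distance_iterations.
  move=> lambda /andP[l0 l1] H; apply: bounded_error_prob_sol => //.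
  apply: bounded_errorW rate1; rewrite alphaE.
  by apply: (distance_iterations M2) => //; rewrite mulr_gt0.
- move=> /rate2 {}rate2 eps eps0.
  have bound e : 0 < e -> Ktilde e <= k%:R ->
      alpha `^ (k%:R / 2) * (1 - alpha)^-1
      * (mu + 2 * L_f + L_f ^+ 2 / mu) * P0 <= e.
    move=> e0 H; rewrite alphaE opprB addrCA subrr addr0 invrK.
    apply: (gap_iterations M2 D0 c2 P00 e0 _ H) => P0_gt0.
    apply: sqrt_sum_le => //.
    (* [C >= 0] is known only in positive dimension, which [P0 > 0] guarantees; hence the
       conditional premise of [gap_iterations]. *)
    have n0 : (0 < n)%N.
      rewrite lt0n; apply/eqP => nE; move: P0_gt0.
      by rewrite /P0 (vec0 nE xstar x0) prox_funxx ltxx.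
    by rewrite divr_ge0 ?(ltW mu0)// mulr_ge0// sumr_ge0// => i _; exact: L_ge0.
  split.
    by move=> H; apply: bounded_error_sol; apply: bounded_errorW rate2; exact: bound.
  move=> lambda /andP[l0 l1] H; apply: bounded_error_prob_sol => //.
  by apply: bounded_errorW rate2; apply: bound => //; rewrite mulr_gt0.
Qed.
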